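(* Let $A\in\mathbb{R}^{m\times m}$, let $f:[0,T]\times\mathbb{R}^m\to\mathbb{R}^m$ be continuous in both arguments and locally Lipschitz continuous in the second argument, and let $y:[0,T]\to\mathbb{R}^m$ be a solution of $$\dot y(t)=Ay(t)+f(t,y(t)),\quad t\in[0,T],\qquad y(0)=y_0,$$ with $y_{ttt}\in L^2(0,T;\mathbb{R}^m)$. Let $K\subset\mathbb{R}^m$ and $L_f\ge 0$ be such that $\|f(t,u)-f(t,v)\|_W\le L_f\|u-v\|_W$ for all $t\in[0,T]$ and $u,v\in K$, and put $c_1=\max\{\|A\|_W,L_f\}$. Then there exists a constant $C_E>0$, which depends on $y$, $T$, $\|A\|_W$ and $L_f$ but is independent of $n$ and $l$, such that the following holds. Let $n\ge 2$, $\Delta t=T/(n-1)$ and $t_j=(j-1)\Delta t$ for $1\le j\le n$, and assume $\Delta t\le 1$ and $c_1\Delta t\le \tfrac12$. Let $\alpha_1,\dots,\alpha_n$ be the trapezoidal weights, let $d$ be the rank of the snapshot matrix $[y(t_1),\dots,y(t_n)]$, let $\{\psi_i^n\}_{i=1}^d$ be the associated POD basis with singular values $\sigma_1\ge\dots\ge\sigma_d>0$, let $l\in\{1,\dots,d\}$, and let $V_n^l=\operatorname{span}\{\psi_1^n,\dots,\psi_l^n\}$. Let $Y_1,\dots,Y_n\in V_n^l$ be a solution of the implicit mid-point scheme for the POD-Galerkin reduced model, $$\left\langle\frac{Y_j-Y_{j-1}}{\Delta t},\psi_i^n\right\rangle_W=\left\langle\frac12A(Y_j+Y_{j-1})+f\!\left(t_j-\frac{\Delta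 t}{2},\frac{Y_j+Y_{j-1}}{2}\right),\psi_i^n\right\rangle_W,\quad 2\le j\le n,$$ $$\langle Y_1,\psi_i^n\rangle_W=\langle y_0,\psi_i^n\rangle_W,$$ for $i=1,\dots,l$, and assume that $y(t_j-\Delta t/2)\in K$ and $(Y_j+Y_{j-1})/2\in K$ for $2\le j\le n$. Then $$\sum_{j=1}^n\alpha_j\|y(t_j)-Y_j\|_W^2\le C_E\left(\sum_{i=l+1}^d\left(2\sigma_i^2+\sum_{j=1}^n\alpha_j\left|\langle\dot y(t_j),\psi_i^n\rangle_W\right|^2\right)+\Delta t^4\right).$$
   Context: $W\in\mathbb{R}^{m\times m}$ is a fixed diagonal matrix with positive diagonal entries. $\mathbb{R}^m$ carries the weighted inner product $\langle u,v\rangle_W=u^TWv$ with norm $\|u\|_W=\langle u,u\rangle_W^{1/2}$, and $\|A\|_W$ is the induced operator norm. The trapezoidal weights are $\alpha_1=\alpha_n=\Delta t/2$ and $\alpha_j=\Delta t$ for $1<j<n$, so that $\sum_{j=1}^n\alpha_j=T$ and $\Delta t\le 2\alpha_j$ for every $j$. POD basis: given the snapshots $y_j=y(t_j)$, $j=1,\dots,n$, with snapshot matrix $Y=[y_1,\dots,y_n]\in\mathbb{R}^{m\times n}$ of rank $d$, let $D=\operatorname{diag}(\alpha_1,\dots,\alpha_n)$ and let $\sigma_1\ge\dots\ge\sigma_d>0$ be the nonzero singular values of $W^{1/2}YD^{1/2}$, with corresponding orthonormal left singular vectors $\tilde u_1,\dots,\tilde u_d$. The POD basis vectors are $\psi_i^n=W^{-1/2}\tilde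 u_i$. They are orthonormal for $\langle\cdot,\cdot\rangle_W$, and for every $l\in\{1,\dots,d\}$ the vectors $\psi_1^n,\dots,\psi_l^n$ minimize $$\sum_{j=1}^n\alpha_j\Big\|y_j-\sum_{k=1}^l\langle y_j,u_k\rangle_W u_k\Big\|_W^2$$ over all $u_1,\dots,u_l\in\mathbb{R}^m$ with $\langle u_i,u_j\rangle_W=\delta_{ij}$, with minimal value $\sum_{i=l+1}^d\sigma_i^2$. The superscript $n$ indicates that the basis depends on the number $n$ of snapshots. Sums over an empty index range are $0$. *)

(* Defs.v *)
From mathcomp Require Import all_boot all_order all_algebra.
From mathcomp Require Import all_classical all_reals all_analysis.
Set Implicit Arguments.
Unset Strict Implicit.
Unset Printing Implicit Defensive.
Import Order.TTheory GRing.Theory Num.Theory.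
Import numFieldNormedType.Exports.
Local Open Scope classical_set_scope.
Local Open Scope ring_scope.

(* Indexing is 0-based throughout: the snapshot times t_1, ..., t_n are
   tgrid dt 0, ..., tgrid dt n.-1, and the modes 1, ..., d are indexed by
   'I_d, so that the sum over l+1 <= i <= d is \sum_(i < d | l <= i). *)

Section WeightedSpace.
Context {R : realType} {m : nat}.
Implicit Types (W A : 'M[R]_m) (u v : 'cV[R]_m).

Definition wdot W u v : R := (u^T *m W *m v) 0 0.
Definition wnorm W u : R := Num.sqrt (wdot W u u).

Definition wopnorm W A : R :=
  sup [set wnorm W (A *m u) | u in [set u | wnorm W u <= 1]].

(* The entrywise square root is the matrix square root when the matrix is
   diagonal with nonnegative entries. *)
Definition sqrt_diag n (D : 'M[R]_n) : 'M[R]_n := map_mx Num.sqrt D.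

End WeightedSpace.

Section POD.
Context {R : realType}.

Definition tgrid (dt : R) (j : nat) : R := j%:R * dt.

Definition trap_weight (n : nat) (dt : R) : 'rV[R]_n :=
  \row_(j < n) (if (j == 0%N :> nat) || (j == n.-1 :> nat) then dt / 2 else dt).

Definition snapshots (m n : nat) (dt : R) (y : R -> 'cV[R]_m) : 'M[R]_(m, n) :=
  \matrix_(i < m, j < n) y (tgrid dt j) i 0.

(* Compact singular value decomposition; it forces d = \rank M, and the
   columns of U and V are orthonormal left and right singular vectors. *)
Definition compact_svd (m n d : nat) (M : 'M[R]_(m, n))
    (U : 'M[R]_(m, d)) (sigma : 'rV[R]_d) (V : 'M[R]_(n, d)) : Prop :=
  [/\ U^T *m U = 1%:M, V^T *m V = 1%:M,
      M = U *m diag_mx sigma *m V^T,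
      forall i : 'I_d, 0 < sigma 0 i
    & forall i j : 'I_d, (i <= j)%N -> sigma 0 j <= sigma 0 i].

(* The POD basis vector psi_i is the column i of Psi. *)
Definition pod_basis (m n d : nat) (W : 'M[R]_m) (Y : 'M[R]_(m, n))
    (alpha : 'rV[R]_n) (sigma : 'rV[R]_d) (Psi : 'M[R]_(m, d)) : Prop :=
  exists (U : 'M[R]_(m, d)) (V : 'M[R]_(n, d)),
    compact_svd (sqrt_diag W *m Y *m sqrt_diag (diag_mx alpha)) U sigma V /\
    Psi = invmx (sqrt_diag W) *m U.

Definition pod_space (m d : nat) (Psi : 'M[R]_(m, d)) (l : nat)
    : {vspace 'cV[R]_m} :=
  <<[seq col i Psi | i : 'I_d <- enum 'I_d & (i < l)%N]>>%VS.

End POD.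

Section TimeRegularity.
Context {R : realType} {m : nat}.
Implicit Types (y dy g : R -> 'cV[R]_m) (f : R -> 'cV[R]_m -> 'cV[R]_m).

(* Derivative along [0, T], hence one-sided at 0 and at T. *)
Definition has_derivative_on (T : R) y dy : Prop :=
  forall t : R, t \in `[0, T] ->
    (fun s : R => (s - t)^-1 *: (y s - y t)) @ within `[0, T] t^' --> dy t.

Definition test_function (T : R) (phi : R -> R) : Prop :=
  (forall (k : nat) (t : R), derivable (derive1n k phi) t 1) /\
  (exists a b : R, [/\ 0 < a, b < T &
     forall t : R, t \notin `[a, b] -> phi t = 0]).

(* g is the third derivative of y on ]0, T[ in the sense of distributions. *)
Definition weak_deriv3 (T : R) y g : Prop :=
  forall phi : R -> R, test_function T phi -> forall i : 'I_m,
    \int[lebesgue_measure]_(t in `]0, T[) (y t i 0 * derive1n 3 phi t) =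
    - \int[lebesgue_measure]_(t in `]0, T[) (g t i 0 * phi t).

Definition in_L2 (T : R) g : Prop :=
  forall i : 'I_m, (fun t => g t i 0) \_ `]0, T[ \in
    Lfun (@lebesgue_measure R) 2%:E.

Definition locally_lipschitz_snd (W : 'M[R]_m) (T : R) f : Prop :=
  forall (t0 : R) (u0 : 'cV[R]_m), t0 \in `[0, T] ->
    exists r L : R, 0 < r /\
      forall (t : R) (u v : 'cV[R]_m), t \in `[0, T] -> `|t - t0| < r ->
        wnorm W (u - u0) < r -> wnorm W (v - u0) < r ->
        wnorm W (f t u - f t v) <= L * wnorm W (u - v).

End TimeRegularity.

(* Implicit mid-point scheme for the Galerkin model on the span of the first
   l columns of Psi; only the values Y 0, ..., Y n.-1 matter. *)
Definition midpoint_scheme (R : realType) (m n d l : nat) (W A : 'M[R]_m)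
    (f : R -> 'cV[R]_m -> 'cV[R]_m) (y0 : 'cV[R]_m) (dt : R)
    (Psi : 'M[R]_(m, d)) (Y : nat -> 'cV[R]_m) : Prop :=
  [/\ forall j : nat, (j < n)%N -> Y j \in pod_space Psi l,
      forall i : 'I_d, (i < l)%N ->
        wdot W (Y 0%N) (col i Psi) = wdot W y0 (col i Psi)
    & forall (j : nat) (i : 'I_d), (j.+1 < n)%N -> (i < l)%N ->
        wdot W (dt^-1 *: (Y j.+1 - Y j)) (col i Psi) =
        wdot W (2^-1 *: (A *m (Y j.+1 + Y j))
                + f (tgrid dt j.+1 - dt / 2) (2^-1 *: (Y j.+1 + Y j)))
          (col i Psi)].

(* Main.v *)
Require Import Defs.
From mathcomp Require Import all_boot all_order all_algebra.
From mathcomp Require Import all_classical all_reals all_analysis.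
From mathcomp Require Import measurable_realfun ring lra.
Import Order.TTheory GRing.Theory Num.Theory.
Import numFieldNormedType.Exports.
Local Open Scope classical_set_scope.
Local Open Scope ring_scope.

(* Let e_j = Y_j - P y(t_j), with P the W-orthogonal projection onto the POD
   space.  Since P is orthogonal for the inner product of the Galerkin scheme,
   the discrete derivative of the projection error drops out, and e_j obeys a
   discrete Gronwall inequality driven by the projection error at the nodes and
   by the consistency errors of the mid-point rule.  The former sums to the
   neglected singular values, so the terms with the time derivative on the
   right-hand side only enter as nonnegative quantities.

   The consistency errors are controlled by third differences of y alone: the
   central quotients with steps s and s/3 differ by one third difference, and
   second differences on a grid change by third differences.  A third difference
   with step s is at most C s^2 times the integral of |y_ttt| over its stencil.
   To get this from the distributional definition, test against a third
   difference of a smoothed truncated power t_+^2/2: its third derivative is a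
   third difference of approximate units, and its sup norm is O(s^2). *)

(** * Smooth functions on the line *)

(** The hypotheses give [y] one pointwise derivative and a distributional third one, but no second
    derivative to expand or integrate by parts with; hence every estimate is stated for finite
    differences of values. The quotient error of the mid-point rule vanishes on quadratics, so third
    differences control it. The averaging error is itself a second difference, and third differences
    only show that second differences vary little along a grid; their size is recovered from the
    increments of [y] next to 0 and [T], bounded by differentiability at these two points. The
    square-integrability enters through a nondecreasing function [I]: local bounds are increments of
    [I], which telescope over a grid, so summation costs no power of [dt]. Test functions vanish
    near 0 and [T], so stencils touching an endpoint are reached by shrinking them and using
    continuity. *)

Section SmoothFunctions.
Context {R : realType}.
Implicit Types (f g df dg : R -> R) (p : {poly R}).

(** The recursion strips one derivative at a time, so that a product or a reciprocal at level [k.+1]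
    reduces to the same operation at level [k]. *)
Fixpoint smooth_upto (k : nat) f : Prop :=
  if k is k'.+1 then (forall t, derivable f t 1) /\ smooth_upto k' (derive1 f)
  else True.

Definition smooth f := forall k, smooth_upto k f.

Lemma derive1_is_derive f df :
  (forall t, is_derive t (1 : R) f (df t)) -> (derive1 f) = df.
Proof.
by move=> fdf; apply/funext => t; rewrite derive1E; apply: derive_val.
Qed.

Lemma smooth_uptoS k f df : (forall t, is_derive t (1 : R) f (df t)) ->
  smooth_upto k df -> smooth_upto k.+1 f.
Proof.
move=> fdf sdf; split; first by move=> t; have [] := fdf t.
by rewrite (derive1_is_derive _ _ fdf).
Qed.

Lemma smooth_upto_is_derive k f : smooth_upto k.+1 f ->
  forall t, is_derive t (1 : R) f ((derive1 f) t).
Proof. by case=> df _ t; rewrite derive1E; exact/derivableP. Qed.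

Lemma smooth_uptoW k f : smooth_upto k.+1 f -> smooth_upto k f.
Proof.
elim: k f => [//|k IH] f [df sf]; split => //.
exact: IH.
Qed.

Lemma smooth_upto_cst k (c : R) : smooth_upto k (cst c).
Proof.
elim: k c => [//|k IH] c.
by apply: smooth_uptoS (IH 0) => t; exact: is_derive_cst.
Qed.

Lemma smooth_uptoD k f g :
  smooth_upto k f -> smooth_upto k g -> smooth_upto k (fun t => f t + g t).
Proof.
elim: k f g => [//|k IH] f g sf sg.
apply: smooth_uptoS (IH _ _ sf.2 sg.2) => t.
have := smooth_upto_is_derive _ _ sf t; have := smooth_upto_is_derive _ _ sg t.
by move=> dg df; exact: is_deriveD.
Qed.

Lemma smooth_uptoM k f g :
  smooth_upto k f -> smooth_upto k g -> smooth_upto k (fun t => f t * g t).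
Proof.
elim: k f g => [//|k IH] f g sf sg.
have s1 := IH _ _ (smooth_uptoW _ _ sf) sg.2.
have s2 := IH _ _ (smooth_uptoW _ _ sg) sf.2.
apply: smooth_uptoS (smooth_uptoD _ _ _ s1 s2) => t.
have df := smooth_upto_is_derive _ _ sf t.
have dg := smooth_upto_is_derive _ _ sg t.
exact: (is_derive_eq (is_deriveM df dg)).
Qed.

(** The derivative of [1/f] is [-(1/f)^2 f'], built from [1/f] itself and [f'], so the induction
    closes through the product lemma. *)
Lemma smooth_uptoV k f : (forall t, f t != 0) ->
  smooth_upto k f -> smooth_upto k (fun t => (f t)^-1).
Proof.
move=> f0; elim: k => [//|k IH] sf.
have sV := IH (smooth_uptoW _ _ sf).
have sd := smooth_uptoM _ _ _ (smooth_uptoM _ _ _ sV sV) sf.2.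
apply: smooth_uptoS (smooth_uptoM _ _ _ (smooth_upto_cst k (-1)) sd) => t.
have df := smooth_upto_is_derive _ _ sf t.
apply: (is_derive_eq (is_deriveV (f0 t) df)).
by rewrite /cst mulN1r scaleNr /GRing.scale/= expr2 invfM.
Qed.

Lemma is_derive_affine (a b t : R) f d :
  is_derive (a * t + b) (1 : R) f d ->
  is_derive t (1 : R) (fun u => f (a * u + b)) (a * d).
Proof.
move=> fd; rewrite mulrC.
apply: (@is_derive1_comp R f (fun u => a * u + b)) => //.
apply: (is_derive_eq (is_deriveD
  (is_deriveZ a (is_derive_id t (1 : R))) (is_derive_cst b t (1 : R)))).
by rewrite addr0 /GRing.scale/= mulr1.
Qed.

Lemma smooth_upto_affine k (a b : R) f :
  smooth_upto k f -> smooth_upto k (fun t => f (a * t + b)).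
Proof.
elim: k f => [//|k IH] f sf.
apply: smooth_uptoS
  (smooth_uptoM _ _ _ (smooth_upto_cst k a) (IH _ sf.2)) => t.
exact: is_derive_affine (smooth_upto_is_derive _ _ sf _).
Qed.

Lemma smooth_id : smooth id.
Proof.
case=> [//|k]; apply: smooth_uptoS (smooth_upto_cst k 1).
Qed.

Lemma smooth_derive1 f : smooth f -> smooth (derive1 f).
Proof. by move=> sf k; have [] := sf k.+1. Qed.

Lemma smooth_derivable f : smooth f -> forall t, derivable f t 1.
Proof. by move=> sf; have [] := sf 1%N. Qed.

Lemma smooth_derive1n f k : smooth f -> smooth (derive1n k f).
Proof.
by elim: k => [//|k IH] sf; rewrite derive1nS; exact/smooth_derive1/IH.
Qed.

Lemma smooth_is_derive f : smooth f -> forall t, is_derive t (1 : R) f ((derive1 f) t).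
Proof. by move=> sf; exact: smooth_upto_is_derive (sf 1%N). Qed.

Lemma smooth_continuous f : smooth f -> continuous f.
Proof.
move=> sf t; apply: differentiable_continuous.
exact/derivable1_diffP/smooth_derivable.
Qed.

Lemma derive1n_affine (a b : R) f k : smooth f ->
  derive1n k (fun t => f (a * t + b)) =
  (fun t => a ^+ k * derive1n k f (a * t + b)).
Proof.
move=> sf; elim: k => [|k IH].
  by apply/funext => t; rewrite expr0 mul1r.
rewrite derive1nS IH; apply: derive1_is_derive => t.
have H : is_derive (a * t + b) (1 : R) (derive1n k f)
    (derive1n k.+1 f (a * t + b)).
  by rewrite derive1nS; exact/smooth_is_derive/smooth_derive1n.
apply: (is_derive_eq (is_deriveZ (a ^+ k) (is_derive_affine _ _ _ _ _ H))).
by rewrite /GRing.scale/= exprSr mulrA.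
Qed.

Lemma derive1n_comb (c1 c2 : R) f g k : smooth f -> smooth g ->
  derive1n k (fun t => c1 * f t + c2 * g t) =
  (fun t => c1 * derive1n k f t + c2 * derive1n k g t).
Proof.
move=> sf sg; elim: k => [//|k IH].
rewrite derive1nS IH; apply: derive1_is_derive => t.
have df := smooth_is_derive _ (smooth_derive1n _ k sf) t.
have dg := smooth_is_derive _ (smooth_derive1n _ k sg) t.
rewrite !derive1nS.
exact: (is_deriveD (is_deriveZ c1 df) (is_deriveZ c2 dg)).
Qed.

Lemma smooth_comb (c1 c2 : R) f g : smooth f -> smooth g ->
  smooth (fun t => c1 * f t + c2 * g t).
Proof.
move=> sf sg k; apply: smooth_uptoD;
by apply: smooth_uptoM (smooth_upto_cst _ _) _.
Qed.

Lemma derive1n_near_eq f g (t : R) k :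
  (\forall u \near t, f u = g u) -> derive1n k f t = derive1n k g t.
Proof.
elim: k f g => [|k IH] f g fg; first exact: (nbhs_singleton fg).
rewrite !derive1Sn; apply: IH.
apply: filterS (near_join fg) => u fgu.
by rewrite !derive1E; exact: near_eq_derive.
Qed.

End SmoothFunctions.

(** * A smooth step function and a smoothed truncated square *)

Section SmoothStep.
Context {R : realType}.
Implicit Types (p : {poly R}) (t : R).

(** These are the functions [p(1/t) exp(-1/t)], extended by 0. Carrying the polynomial closes the
    family under differentiation, so one induction proves all of them smooth; [p = 1] is the
    classical flat function. *)
Definition flat p t : R := if 0 < t then p.[t^-1] * expR (- t^-1) else 0.

Lemma flat_le0 p t : t <= 0 -> flat p t = 0.
Proof. by rewrite /flat leNgt => /negbTE ->. Qed.

(** Linear decay is what differentiability at 0 requires; it comes from [u^(k+1) / (k+1)! <= exp u]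
    at [u = 1/t]. *)
Lemma flat_bound p :
  exists2 C : R, 0 <= C & forall t, `|flat p t| <= C * `|t|.
Proof.
(* The power ['X^k] is an accumulator for the Horner induction: multiplied by it, [q * 'X + c]
   splits into [q * 'X^k.+1] and a monomial. *)
suff H (q : {poly R}) k : exists2 C : R, 0 <= C & forall u, 0 < u ->
    `|(q * 'X^k).[u]| * expR (- u) <= C / u.
  have [C C0 HC] := H p 0%N; exists C => // t.
  rewrite /flat; case: ifPn => t0; last by rewrite normr0 mulr_ge0.
  rewrite normrM (gtr0_norm t0) (gtr0_norm (expR_gt0 _)).
  have := HC t^-1; rewrite invr_gt0 invrK expr0 mulr1; exact.
elim/poly_ind: q k => [|q c IH] k.
  by exists 0 => // u u0; rewrite mul0r horner0 normr0 !mul0r.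
have [C C0 HC] := IH k.+1.
exists (C + `|c| * k.+1`!%:R) => [|u u0].
  by rewrite addr_ge0// mulr_ge0.
have ek : u ^+ k * expR (- u) <= k.+1`!%:R / u.
  rewrite expRN ler_pdivlMr// mulrAC ler_pdivrMr ?expR_gt0// -exprSr.
  rewrite mulrC -ler_pdivrMr ?ltr0n ?fact_gt0//.
  apply: le_trans (expR_ge1Dxn k (ltW u0)).
  by rewrite lerDr.
rewrite mulrDl -mulrA -exprS hornerD mulrDl.
apply: le_trans (ler_wpM2r (expR_ge0 _) (ler_normD _ _)) _.
rewrite mulrDl lerD// ?HC//.
rewrite hornerM hornerC hornerXn normrM -!mulrA ler_wpM2l//.
by rewrite ger0_norm// exprn_ge0// ltW.
Qed.

Lemma flatMX p t : flat p t = flat (p * 'X) t * t.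
Proof.
rewrite /flat; case: ifPn => t0; last by rewrite mul0r.
by rewrite hornerMX mulrAC -(mulrA p.[_]) mulVf ?mulr1 ?gt_eqF.
Qed.

Lemma flat_is_derive p t :
  is_derive t (1 : R) (flat p) (flat ('X^2 * (p - p^`())) t).
Proof.
have [t0|t0|->] := ltgtP t 0.
- rewrite flat_le0 ?(ltW t0)//.
  apply: (@near_eq_is_derive _ _ _ (cst 0)).
  near=> u; rewrite flat_le0//; near: u.
  by apply: filterS (lt_nbhsl t0) => u /ltW.
- pose h u := p.[u^-1] * expR (- u^-1).
  apply: (@near_eq_is_derive _ _ _ h).
    near=> u; rewrite /flat ifT//; near: u.
    exact: lt_nbhsr.
  have tn0 : id t != 0 :> R by rewrite gt_eqF.
  have dV := is_deriveV tn0 (is_derive_id t (1 : R)).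
  have dp := is_derive1_comp (is_derive_poly p t^-1) dV.
  have dE := @is_derive1_comp R expR (fun u => - u^-1) _ _ _
    (is_derive_expR (- t^-1)) (is_deriveN dV).
  apply: (is_derive_eq (is_deriveM dp dE)).
  rewrite /flat t0 hornerM hornerXn hornerD hornerN /GRing.scale/= exprVn.
  by field.
(* At 0 the function [flat (p * 'X)] is the difference quotient, and the linear bound makes it
   continuous there with value 0. *)
- rewrite flat_le0//; apply/is_derive1_caratheodory.
  exists (flat (p * 'X)); split.
  + by move=> z; rewrite (flat_le0 p 0 (lexx 0)) !subr0; exact: flatMX.
  + have [C C0 HC] := flat_bound (p * 'X).
    have -> : {for 0, continuous (flat (p * 'X))} =
        (flat (p * 'X) x @[x --> (0 : R)] --> flat (p * 'X) 0) by [].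
    rewrite (flat_le0 _ 0)//; apply/cvgr0Pnorm_lt => e e0.
    near=> u; apply: le_lt_trans (HC u) _.
    rewrite (@le_lt_trans _ _ ((C + 1) * `|u|))// ?ler_wpM2r ?lerDl//.
    rewrite -ltr_pdivlMl ?ltr_wpDl//; near: u.
    exists ((C + 1)^-1 * e) => [|u] /=; last by rewrite sub0r normrN.
    by rewrite mulr_gt0 ?invr_gt0 ?ltr_wpDl.
  + exact: flat_le0.
Unshelve. all: by end_near. Qed.

Lemma smooth_flat p : smooth (flat p).
Proof.
move=> k; elim: k p => [//|k IH] p.
exact: smooth_uptoS (flat_is_derive p) (IH _).
Qed.

Lemma flat1_ge0 t : 0 <= flat 1 t.
Proof. by rewrite /flat; case: ifP => // _; rewrite mulr_ge0 ?expR_ge0// hornerC. Qed.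

Lemma flat1_gt0 t : 0 < t -> 0 < flat 1 t.
Proof. by rewrite /flat => ->; rewrite mulr_gt0 ?expR_gt0// hornerC. Qed.

Definition step t := flat 1 t / (flat 1 t + flat 1 (1 - t)).

Lemma step_den_gt0 t : 0 < flat 1 t + flat 1 (1 - t).
Proof.
have [t0|t0] := ltP 0 t; first by rewrite ltr_pwDl ?flat1_gt0 ?flat1_ge0.
by rewrite ltr_wpDl ?flat1_gt0 ?flat1_ge0//; lra.
Qed.

Lemma smooth_step : smooth step.
Proof.
move=> k; apply: smooth_uptoM; first exact: smooth_flat.
apply: smooth_uptoV => [t|]; first by rewrite gt_eqF ?step_den_gt0.
apply: smooth_uptoD; first exact: smooth_flat.
have -> : (fun t => flat 1 (1 - t)) = (fun t => flat 1 (-1 * t + 1)).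
  by apply/funext => t; rewrite mulN1r addrC.
exact/smooth_upto_affine/smooth_flat.
Qed.

Lemma step_le0 t : t <= 0 -> step t = 0.
Proof. by move=> t0; rewrite /step flat_le0// mul0r. Qed.

Lemma step_ge1 t : 1 <= t -> step t = 1.
Proof.
move=> t1; rewrite /step (flat_le0 1 (1 - t)) ?subr_le0// addr0 divff//.
by rewrite gt_eqF// flat1_gt0//; lra.
Qed.

Lemma step_ge0 t : 0 <= step t.
Proof. by rewrite divr_ge0 ?flat1_ge0// ltW// step_den_gt0. Qed.

Lemma step_le1 t : step t <= 1.
Proof. by rewrite ler_pdivrMr ?step_den_gt0// mul1r lerDl flat1_ge0. Qed.

(* A smooth version of the truncated power t_+^2/2, whose third derivative is
   an approximate unit. *)
Definition sqstep t := t * t / 2 * step t.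

Lemma smooth_sqstep : smooth sqstep.
Proof.
move=> k; apply: smooth_uptoM; last exact: smooth_step.
apply: smooth_uptoM (smooth_upto_cst _ _).
by apply: smooth_uptoM; exact: smooth_id.
Qed.

Lemma sqstep_le0 t : t <= 0 -> sqstep t = 0.
Proof. by move=> t0; rewrite /sqstep step_le0// mulr0. Qed.

Lemma sqstep_ge1 t : 1 <= t -> sqstep t = t * t / 2.
Proof. by move=> t0; rewrite /sqstep step_ge1// mulr1. Qed.

Lemma sqstep_bound t : `|sqstep t| <= t * t / 2.
Proof.
have t2 : 0 <= t * t / 2 by rewrite -expr2 divr_ge0// sqr_ge0.
rewrite /sqstep normrM (ger0_norm t2) (ger0_norm (step_ge0 t)).
by rewrite ler_piMr// step_le1.
Qed.

Lemma is_derive_sqr2 t : is_derive t (1 : R) (fun u => u * u / 2) t.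
Proof.
have d := is_deriveM (is_derive_id t (1 : R)) (is_derive_id t (1 : R)).
have d2 := is_deriveM d (is_derive_cst (2^-1 : R) t (1 : R)).
rewrite (_ : (fun u => _) = (@id R * @id R) * cst 2^-1)//.
apply: (is_derive_eq d2).
by rewrite scaler0 add0r /GRing.scale/=; lra.
Qed.

Lemma derive1n_sqstep_lt0 k t : t < 0 -> derive1n k sqstep t = 0.
Proof.
move=> t0; rewrite (@derive1n_near_eq _ _ (cst 0)); last first.
  near=> u; rewrite sqstep_le0//; near: u.
  by apply: filterS (lt_nbhsl t0) => u /ltW.
elim: k => [//|k IH]; elim: k {IH} => [|k IH]; first by rewrite derive1n1 derive1_cst.
by rewrite derive1Sn (_ : derive1 (cst 0) = cst 0)//; apply/funext => u; rewrite derive1_cst.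
Unshelve. all: by end_near. Qed.

Lemma derive1_sqr2 : derive1 (fun u : R => u * u / 2) = id.
Proof. exact: derive1_is_derive is_derive_sqr2. Qed.

Lemma derive1n_sqstep_gt1 k t : 1 < t ->
  derive1n k sqstep t = derive1n k (fun u => u * u / 2) t.
Proof.
move=> t1; apply: derive1n_near_eq; near=> u; rewrite sqstep_ge1//; near: u.
by apply: filterS (lt_nbhsr t1) => u /ltW.
Unshelve. all: by end_near. Qed.

Definition approx_unit := derive1n 3 sqstep.

Lemma approx_unit_lt0 t : t < 0 -> approx_unit t = 0.
Proof. exact: derive1n_sqstep_lt0. Qed.

Lemma approx_unit_gt1 t : 1 < t -> approx_unit t = 0.
Proof.
move=> t1; rewrite /approx_unit derive1n_sqstep_gt1// 2!derive1Sn derive1_sqr2.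
rewrite (_ : derive1 id = cst 1); last by apply/funext => u; exact: derive1_id.
by rewrite derive1n1 derive1_cst.
Qed.

Lemma smooth_approx_unit : smooth approx_unit.
Proof. exact: smooth_derive1n smooth_sqstep. Qed.

(** The mass of [approx_unit] is the total rise, from 0 to 1, of the second derivative of [sqstep].
    The points -1 and 2 lie strictly outside [[0, 1]] because derivatives are read off a
    neighbourhood; hence the intervals [[p - e, p + 2 * e]] below. *)
Lemma approx_unit_primitive :
  (forall t, is_derive t (1 : R) (derive1n 2 sqstep) (approx_unit t)) /\
  derive1n 2 sqstep 2 - derive1n 2 sqstep (-1) = 1.
Proof.
split.
  move=> t; rewrite /approx_unit derive1nS.
  exact: (smooth_is_derive _ (smooth_derive1n _ 2 smooth_sqstep)).
rewrite (derive1n_sqstep_lt0 2 (-1)) ?ltrN10// subr0 derive1n_sqstep_gt1 ?ltr1n//.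
by rewrite derive1Sn derive1_sqr2 derive1n1 derive1_id.
Qed.

(** No sign of [approx_unit] is established; that it acts as an approximate unit rests on its mass 1
    and on this bound. *)
Lemma approx_unit_bounded : exists2 M, 0 < M & forall t, `|approx_unit t| <= M.
Proof.
have cA := smooth_continuous _ smooth_approx_unit.
have cN : {within `[0, 1], continuous (fun t => `|approx_unit t|)}.
  apply: continuous_subspaceT => t.
  by apply: continuous_comp; [exact: cA | exact: norm_continuous].
have [c _ Hc] := EVT_max ler01 cN.
exists (`|approx_unit c| + 1) => [|t]; first by rewrite ltr_wpDl.
have [t0|t0] := ltP t 0; first by rewrite approx_unit_lt0// normr0 addr_ge0.
have [t1|t1] := ltP 1 t; first by rewrite approx_unit_gt1// normr0 addr_ge0.
have tI : t \in `[0, 1] by rewrite in_itv/= t0 t1.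
apply: le_trans (Hc t tI) _.
by rewrite lerDl.
Qed.

End SmoothStep.

Opaque flat step sqstep approx_unit.

(** * Third differences of functions with a weak third derivative *)

Section ThirdDifference.
Context {R : realType}.
Notation mu := (@lebesgue_measure R).
Implicit Types (h g : R -> R) (e p t x s T : R).

Lemma within_continuousP (A : set R) h :
  {within A, continuous h} <->
  forall q, A q -> forall d, 0 < d ->
    exists2 r, 0 < r & forall t, A t -> `|t - q| < r -> `|h t - h q| < d.
Proof.
rewrite subspace_continuousP; split => H q Aq.
- move=> d d0; have /cvgrPdist_lt/(_ d d0) := H q Aq.
  case=> r /= r0 Hr; exists r => // t At tq; rewrite distrC; apply: Hr => //=.
  by rewrite distrC.
- apply/cvgrPdist_lt => d d0; have [r r0 Hr] := H q Aq d d0.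
  exists r => // t /= qt At; rewrite distrC; apply: Hr => //.
  by rewrite distrC.
Qed.

(** Since [t_+^2/2] is homogeneous of degree 2, the rescaling still equals [(t - p)^2/2] past
    [p + e], while its third derivative is an approximate unit at scale [e]. The argument
    [(t - p)/e] is written in the affine form of [derive1n_affine]. *)
Definition spline e p t := e ^+ 2 * sqstep (e^-1 * t + - (p / e)).
Definition bump_unit e p t := e^-1 * approx_unit (e^-1 * t + - (p / e)).

Lemma scaled_arg e p t : e^-1 * t + - (p / e) = (t - p) / e.
Proof. by rewrite mulrBl mulrC. Qed.

Lemma smooth_spline e p : smooth (spline e p).
Proof.
move=> k; apply: smooth_uptoM; first exact: smooth_upto_cst.
exact/smooth_upto_affine/smooth_sqstep.
Qed.

Lemma derive3_spline e p : e != 0 -> derive1n 3 (spline e p) = bump_unit e p.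
Proof.
move=> e0; set f := fun t => sqstep (e^-1 * t + - (p / e)).
have sf : smooth f by move=> k; exact/smooth_upto_affine/smooth_sqstep.
have -> : spline e p = (fun t => e ^+ 2 * f t + 0 * f t).
  by apply/funext => t; rewrite mul0r addr0.
rewrite derive1n_comb// /f derive1n_affine; last exact: smooth_sqstep.
apply/funext => t; rewrite mul0r addr0 mulrA /bump_unit; congr (_ * _).
by rewrite exprVn; field.
Qed.

Lemma spline_le e p t : 0 < e -> t <= p -> spline e p t = 0.
Proof.
move=> e0 tp; rewrite /spline scaled_arg sqstep_le0 ?mulr0//.
by rewrite pmulr_lle0 ?invr_gt0// subr_le0.
Qed.

Lemma spline_ge e p t : 0 < e -> p + e <= t -> spline e p t = (t - p) ^+ 2 / 2.
Proof.
move=> e0 tp; rewrite /spline scaled_arg sqstep_ge1; first by field; rewrite gt_eqF.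
by rewrite ler_pdivlMr// mul1r; lra.
Qed.

Lemma spline_bound e p t : 0 < e -> `|spline e p t| <= (t - p) ^+ 2 / 2.
Proof.
move=> e0; rewrite /spline scaled_arg normrM ger0_norm ?sqr_ge0//.
apply: le_trans (ler_wpM2l (sqr_ge0 e) (sqstep_bound _)) _.
by rewrite le_eqVlt; apply/orP; left; apply/eqP; field; rewrite gt_eqF.
Qed.

Lemma bump_unit_out e p t : 0 < e -> t \notin `[p - e, p + 2 * e] ->
  bump_unit e p t = 0.
Proof.
move=> e0; rewrite in_itv/= negb_and -!ltNge /bump_unit scaled_arg => /orP[tp|tp].
- rewrite approx_unit_lt0 ?mulr0// pmulr_llt0 ?invr_gt0//; lra.
- rewrite approx_unit_gt1 ?mulr0// ltr_pdivlMr//; lra.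
Qed.

Lemma continuous_bump_unit e p : continuous (bump_unit e p).
Proof.
apply: smooth_continuous => k; apply: smooth_uptoM; first exact: smooth_upto_cst.
exact/smooth_upto_affine/smooth_approx_unit.
Qed.

Lemma Rintegral_bump_unit e p : 0 < e ->
  \int[mu]_(t in `[p - e, p + 2 * e]) bump_unit e p t = 1.
Proof.
move=> e0; have ltp : p - e < p + 2 * e by lra.
have [dP P1] := @approx_unit_primitive R.
pose F t := derive1n 2 sqstep (e^-1 * t + - (p / e)).
have dF t : is_derive t (1 : R) F (bump_unit e p t).
  exact: is_derive_affine (dP _).
rewrite /Rintegral (@continuous_FTC2 _ _ F).
- rewrite -EFinD/= /F !scaled_arg.
  have -> : (p + 2 * e - p) / e = 2 by field; rewrite gt_eqF.
  by have -> : (p - e - p) / e = -1 by field; rewrite gt_eqF.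
- exact: ltp.
- exact/continuous_subspaceT/continuous_bump_unit.
- have cF : continuous F.
    move=> t; apply: differentiable_continuous; apply/derivable1_diffP.
    by case: (dF t).
  split; first by move=> t _; case: (dF t).
  + exact/cvg_at_right_filter/cF.
  + exact/cvg_at_left_filter/cF.
- by move=> t _; rewrite derive1E; case: (dF t).
Qed.

Lemma mkcond_bump T h e p : 0 < e -> 0 < p - e -> p + 2 * e < T ->
  (fun t => h t * bump_unit e p t) \_ `]0, T[ =
  (fun t => h t * bump_unit e p t) \_ `[p - e, p + 2 * e].
Proof.
move=> e0 p0 pT; apply/funext => t; rewrite !patchE !mem_setE.
case: ifPn => [_|t1]; case: ifPn => [t2|t2] //.
- by rewrite bump_unit_out ?mulr0.
- move: t1; rewrite in_itv/= negb_and -!leNgt.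
  by move: t2; rewrite in_itv/= => /andP[? ?] /orP[?|?]; lra.
Qed.

Lemma integrable_bump T h e p : {within `[0, T], continuous h} ->
  0 < e -> 0 < p - e -> p + 2 * e < T ->
  mu.-integrable `]0, T[ (EFin \o (fun t => h t * bump_unit e p t)) /\
  mu.-integrable `[p - e, p + 2 * e] (EFin \o (fun t => h t * bump_unit e p t)).
Proof.
move=> ch e0 p0 pT.
have I2 : mu.-integrable `[p - e, p + 2 * e]
    (EFin \o (fun t => h t * bump_unit e p t)).
  apply: continuous_compact_integrable; first exact: segment_compact.
  move=> t; apply: (@continuousM _ (subspace `[p - e, p + 2 * e])).
    apply: continuous_subspaceW ch _ => u /=; rewrite !in_itv/= => /andP[? ?].
    by apply/andP; split; lra.
  exact/continuous_subspaceT/continuous_bump_unit.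
split => //; apply/integrable_mkcond => //.
move/integrable_mkcond : I2 => /(_ (measurable_itv _)).
by rewrite !restrict_EFin (mkcond_bump T).
Qed.

Lemma Rintegral_cst_itv (a b c : R) : a <= b ->
  \int[mu]_(t in `[a, b]) c = c * (b - a).
Proof.
move=> ab; rewrite Rintegral_cst//.
have -> : fine (mu `[a, b]%classic) = b - a; last by [].
rewrite lebesgue_measure_itv/= lte_fin.
by case: ltgtP ab => // -> _; rewrite subrr.
Qed.

Lemma bump_unit_approx T h e p M d : {within `[0, T], continuous h} ->
  0 < e -> 0 < p - e -> p + 2 * e < T ->
  (forall t, `|approx_unit t| <= M) ->
  (forall t, t \in `[p - e, p + 2 * e] -> `|h t - h p| <= d) ->
  `|\int[mu]_(t in `]0, T[) (h t * bump_unit e p t) - h p| <= 3 * M * d.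
Proof.
move=> ch e0 p0 pT HM Hd.
have [I1 I2] := integrable_bump _ _ _ _ ch e0 p0 pT.
rewrite Rintegral_mkcond (mkcond_bump T)// -Rintegral_mkcond.
set D := [set` `[p - e, p + 2 * e]] in I2 *.
have mD : @measurable _ (measurableTypeR R) D by exact: measurable_itv.
have ccI (c : R -> R) : continuous c -> mu.-integrable D (EFin \o c).
  move=> cc; apply: continuous_compact_integrable; first exact: segment_compact.
  exact: continuous_subspaceT.
have Ib : mu.-integrable D (EFin \o bump_unit e p).
  exact/ccI/continuous_bump_unit.
have Ihb : mu.-integrable D (EFin \o (fun t => h p * bump_unit e p t)).
  apply: ccI => t; apply: continuousM; first exact: cvg_cst.
  exact: continuous_bump_unit.
have -> : h p = \int[mu]_(t in D) (h p * bump_unit e p t).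
  by rewrite RintegralZl// Rintegral_bump_unit// mulr1.
rewrite -RintegralB//.
have Idiff : mu.-integrable D
    (EFin \o (fun t => h t * bump_unit e p t - h p * bump_unit e p t)).
  by apply: (eq_integrable mD _ _ _ (integrableB mD I2 Ihb)) => t _ /=; rewrite EFinB.
apply: le_trans (le_normr_Rintegral mD Idiff) _.
(* The interval has length [3 * e], and the integrand is at most [M * d / e]. *)
have -> : 3 * M * d = \int[mu]_(t in D) (M * d / e).
  rewrite Rintegral_cst_itv; last lra.
  by field; rewrite gt_eqF.
apply: le_Rintegral => //.
- have /integrable_abse := Idiff.
  by apply: eq_integrable => // t _ /=.
- exact/ccI/cst_continuous.
- move=> t Dt; have Hdt := Hd t Dt; have HMt := HM (e^-1 * t + - (p / e)).
  rewrite -mulrBl normrM /bump_unit normrM (gtr0_norm (_ : 0 < e^-1)) ?invr_gt0//.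
  rewrite (_ : M * d / e = d * (e^-1 * M)); last by rewrite mulrAC mulrC (mulrC M).
  apply: ler_pM => //; first by rewrite mulr_ge0// invr_ge0 ltW.
  by rewrite ler_pM2l ?invr_gt0.
Qed.


End ThirdDifference.

Opaque spline bump_unit.

(** * Third differences tested against B-splines *)

Section ThirdDifferenceBound.
Context {R : realType}.
Notation mu := (@lebesgue_measure R).
Implicit Types (h g : R -> R) (a b e p t x s T : R).

Definition diff3 h x s := h (x + 3 * s) - 3 * h (x + 2 * s) + 3 * h (x + s) - h x.

(** Up to the smoothing, this is [s^2] times the quadratic cardinal B-spline. Its third derivative
    approximates minus the third difference functional, which cancels the sign in the weak
    derivative. The nesting in pairs fits [derive1n_comb]. *)
Definition bspline e x s t :=
  1 * (1 * spline e x t + (-3) * spline e (x + s) t) +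
  1 * (3 * spline e (x + 2 * s) t + (-1) * spline e (x + 3 * s) t).

Lemma smooth_bspline e x s : smooth (bspline e x s).
Proof. by do 2![apply: smooth_comb]; exact: smooth_spline. Qed.

Lemma derive3_bspline e x s t : e != 0 -> derive1n 3 (bspline e x s) t =
  (bump_unit e x t - 3 * bump_unit e (x + s) t) +
  (3 * bump_unit e (x + 2 * s) t - bump_unit e (x + 3 * s) t).
Proof.
move=> e0; have ss p := smooth_spline e p.
rewrite /bspline derive1n_comb; [|exact: smooth_comb..].
rewrite !derive1n_comb// !derive3_spline//.
move: (bump_unit e x t) (bump_unit e (x + s) t) (bump_unit e (x + 2 * s) t)
  (bump_unit e (x + 3 * s) t) => u1 u2 u3 u4; ring.
Qed.

(** To the right of the interval all four splines are exact quadratics, which a third difference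
    annihilates; to the left they all vanish. *)
Lemma bspline_out e x s t : 0 < e -> 0 < s ->
  t \notin `[x, x + 3 * s + e] -> bspline e x s t = 0.
Proof.
move=> e0 s0; rewrite in_itv/= negb_and -!ltNge => /orP[tx|tx].
  by rewrite /bspline !spline_le//; lra.
by rewrite /bspline !spline_ge//; lra.
Qed.

(** On the support every [|t - p|] is at most [3 * s + e <= 4 * s], so each spline is at most
    [8 * s^2], and the coefficients 1, 3, 3, 1 add up to 8. *)
Lemma bspline_bound e x s t : 0 < e -> e <= s -> `|bspline e x s t| <= 64 * s ^+ 2.
Proof.
move=> e0 es; have s0 : 0 < s by exact: lt_le_trans es.
have [/=|tI] := boolP (t \in `[x, x + 3 * s + e]); last first.
  by rewrite bspline_out// normr0 mulr_ge0// sqr_ge0.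
rewrite in_itv/= => /andP[xt txs].
have B p : x <= p <= x + 3 * s -> `|spline e p t| <= 8 * s ^+ 2.
  move=> /andP[xp px]; apply: le_trans (spline_bound e p t e0) _.
  have H : 0 <= (4 * s - (t - p)) * (4 * s + (t - p)).
    by apply: mulr_ge0; clear -xp px xt txs es; lra.
  by clear -H; lra.
have /ler_normlP[? ?] : `|spline e x t| <= 8 * s ^+ 2.
  by apply: B; apply/andP; split; lra.
have /ler_normlP[? ?] : `|spline e (x + s) t| <= 8 * s ^+ 2.
  by apply: B; apply/andP; split; lra.
have /ler_normlP[? ?] : `|spline e (x + 2 * s) t| <= 8 * s ^+ 2.
  by apply: B; apply/andP; split; lra.
have /ler_normlP[? ?] : `|spline e (x + 3 * s) t| <= 8 * s ^+ 2.
  by apply: B; apply/andP; split; lra.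
by apply/ler_normlP; rewrite /bspline; split; lra.
Qed.

Lemma test_bspline T e x s : 0 < x -> 0 < e -> 0 < s -> x + 3 * s + e < T ->
  test_function T (bspline e x s).
Proof.
move=> x0 e0 s0 xT; split.
  by move=> k; apply: smooth_derivable; exact/smooth_derive1n/smooth_bspline.
exists x, (x + 3 * s + e); split => //.
by move=> t; exact: bspline_out.
Qed.

Lemma bump_unit_cvg T h p d : {within `[0, T], continuous h} ->
  0 < p -> p < T -> 0 < d ->
  exists2 r, 0 < r & forall e, 0 < e -> e < r ->
    mu.-integrable `]0, T[ (EFin \o (fun t => h t * bump_unit e p t)) /\
    `|\int[mu]_(t in `]0, T[) (h t * bump_unit e p t) - h p| <= d.
Proof.
move=> ch p0 pT d0; have [M M0 HM] := @approx_unit_bounded R.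
have d'0 : 0 < d / (3 * M) by rewrite divr_gt0// mulr_gt0.
have pI : `[0, T]%classic p by rewrite /= in_itv/= !ltW.
have /within_continuousP/(_ p pI _ d'0)[r r0 Hr] := ch.
(* These bounds keep [[p - e, p + 2 * e]] within distance [r] of [p] and inside []0, T[]. *)
exists (Num.min (r / 2) (Num.min (p / 2) ((T - p) / 2))) => [|e e0].
  by rewrite !lt_min !divr_gt0// subr_gt0.
rewrite !lt_min => /and3P[er ep eT].
have ep' : 0 < p - e by clear -ep e0; lra.
have eT' : p + 2 * e < T by clear -eT e0; lra.
split; first by have [] := integrable_bump T h e p ch e0 ep' eT'.
have -> : d = 3 * M * (d / (3 * M)) by field; rewrite gt_eqF.
apply: bump_unit_approx => // t; rewrite in_itv/= => /andP[t1 t2].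
apply/ltW/Hr => /=.
  by rewrite in_itv/=; apply/andP; split; clear -t1 t2 ep' eT'; lra.
by apply/ltr_normlP; split; clear -t1 t2 e0 er; lra.
Qed.

Lemma Rintegral_comb (D : set (measurableTypeR R)) (f1 f2 : R -> R) (c1 c2 : R) :
  measurable D ->
  mu.-integrable D (EFin \o f1) -> mu.-integrable D (EFin \o f2) ->
  mu.-integrable D (EFin \o (fun t => c1 * f1 t + c2 * f2 t)) /\
  \int[mu]_(t in D) (c1 * f1 t + c2 * f2 t) =
    c1 * \int[mu]_(t in D) f1 t + c2 * \int[mu]_(t in D) f2 t.
Proof.
move=> mD i1 i2.
have I1 : mu.-integrable D (EFin \o (fun t => c1 * f1 t)).
  by apply: (eq_integrable mD _ _ _ (integrableZl mD c1 i1)) => t _ /=; rewrite EFinM.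
have I2 : mu.-integrable D (EFin \o (fun t => c2 * f2 t)).
  by apply: (eq_integrable mD _ _ _ (integrableZl mD c2 i2)) => t _ /=; rewrite EFinM.
split; last by rewrite RintegralD// !RintegralZl.
by apply: (eq_integrable mD _ _ _ (integrableD mD I1 I2)) => t _ /=; rewrite EFinD.
Qed.

Lemma Rintegral_comb4 (D : set (measurableTypeR R)) (f1 f2 f3 f4 : R -> R)
    (c1 c2 c3 c4 : R) : measurable D ->
  mu.-integrable D (EFin \o f1) -> mu.-integrable D (EFin \o f2) ->
  mu.-integrable D (EFin \o f3) -> mu.-integrable D (EFin \o f4) ->
  \int[mu]_(t in D) (c1 * f1 t + c2 * f2 t + (c3 * f3 t + c4 * f4 t)) =
    c1 * \int[mu]_(t in D) f1 t + c2 * \int[mu]_(t in D) f2 t +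
    (c3 * \int[mu]_(t in D) f3 t + c4 * \int[mu]_(t in D) f4 t).
Proof.
move=> mD I1 I2 I3 I4.
have [I12 <-] := Rintegral_comb _ _ _ c1 c2 mD I1 I2.
have [I34 <-] := Rintegral_comb _ _ _ c3 c4 mD I3 I4.
by rewrite RintegralD.
Qed.

Lemma Rintegral_derive3_bspline T h x s d : {within `[0, T], continuous h} ->
  0 < x -> 0 < s -> x + 3 * s < T -> 0 < d ->
  exists2 r, 0 < r & forall e, 0 < e -> e < r ->
  `|\int[mu]_(t in `]0, T[) (h t * derive1n 3 (bspline e x s) t) + diff3 h x s|
    <= d.
Proof.
(* The coefficients 1, 3, 3, 1 have sum 8, so each point value may be off by [d / 8]. *)
move=> ch x0 s0 xT d0; have d80 : 0 < d / 8 by rewrite divr_gt0.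
have [||r1 r10 H1] := bump_unit_cvg T h x _ ch _ _ d80; [clear -x0 s0 xT; lra..|].
have [||r2 r20 H2] := bump_unit_cvg T h (x + s) _ ch _ _ d80;
  [clear -x0 s0 xT; lra..|].
have [||r3 r30 H3] := bump_unit_cvg T h (x + 2 * s) _ ch _ _ d80;
  [clear -x0 s0 xT; lra..|].
have [||r4 r40 H4] := bump_unit_cvg T h (x + 3 * s) _ ch _ _ d80;
  [clear -x0 s0 xT; lra..|].
exists (Num.min (Num.min r1 r2) (Num.min r3 r4)); first by rewrite !lt_min r10 r20 r30.
move=> e e0; rewrite !lt_min => /andP[/andP[er1 er2] /andP[er3 er4]].
have [I1 K1] := H1 e e0 er1; have [I2 K2] := H2 e e0 er2.
have [I3 K3] := H3 e e0 er3; have [I4 K4] := H4 e e0 er4.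
have mD : @measurable _ (measurableTypeR R) `]0, T[ by exact: measurable_itv.
have E := Rintegral_comb4 _ _ _ _ _ 1 (-3) 3 (-1) mD I1 I2 I3 I4.
have lin (J1 J2 J3 J4 : R) : `|J1 - h x| <= d / 8 -> `|J2 - h (x + s)| <= d / 8 ->
    `|J3 - h (x + 2 * s)| <= d / 8 -> `|J4 - h (x + 3 * s)| <= d / 8 ->
    `|1 * J1 + (-3) * J2 + (3 * J3 + (-1) * J4) + diff3 h x s| <= d.
  rewrite /diff3; clear.
  move=> /ler_normlP[? ?] /ler_normlP[? ?] /ler_normlP[? ?] /ler_normlP[? ?].
  by apply/ler_normlP; split; lra.
move: (lin _ _ _ _ K1 K2 K3 K4); rewrite -E => {lin E}.
congr (`|_ + _| <= d); apply: eq_Rintegral => t _.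
rewrite derive3_bspline ?gt_eqF//.
move: (bump_unit e x t) (bump_unit e (x + s) t) (bump_unit e (x + 2 * s) t)
  (bump_unit e (x + 3 * s) t) => u1 u2 u3 u4; ring.
Qed.

Lemma Rintegral_mul_bspline T g e a b x s :
  mu.-integrable `]0, T[ (EFin \o g) ->
  0 < e -> e <= s -> 0 <= a -> a < x -> x + 3 * s + e < b -> b <= T ->
  `|\int[mu]_(t in `]0, T[) (g t * bspline e x s t)| <=
    64 * s ^+ 2 * \int[mu]_(t in `]a, b[) `|g t|.
Proof.
move=> ig e0 es a0 ax xb bT.
have sD : `]a, b[ `<=` (`]0, T[ : set R).
  by move=> t /=; rewrite !in_itv/= => /andP[? ?]; apply/andP; split; lra.
have mab : @measurable _ (measurableTypeR R) `]a, b[ by exact: measurable_itv.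
have m0T : @measurable _ (measurableTypeR R) `]0, T[ by exact: measurable_itv.
have igab : mu.-integrable `]a, b[ (EFin \o g) by exact: integrableS ig.
have -> : \int[mu]_(t in `]0, T[) (g t * bspline e x s t) =
    \int[mu]_(t in `]a, b[) (g t * bspline e x s t).
  rewrite Rintegral_mkcond [RHS]Rintegral_mkcond; congr (Rintegral _ _ _).
  apply/funext => t; rewrite !patchE !mem_setE.
  have [tab|tab] := boolP (t \in `]a, b[).
    by rewrite (_ : t \in _)//; exact: sD.
  case: ifPn => // _; rewrite bspline_out ?mulr0//; first lra.
  apply: contra tab; rewrite !in_itv/= => /andP[? ?].
  by apply/andP; split; lra.
have mB : measurable_fun (setT : set (measurableTypeR R)) (bspline e x s).
  exact: (continuous_measurable_fun (smooth_continuous _ (smooth_bspline e x s))).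
have iag : mu.-integrable `]a, b[ (EFin \o (fun t => `|g t|)).
  by apply: (eq_integrable mab _ _ _ (integrable_abse igab)).
have HB t : `|g t * bspline e x s t| <= 64 * s ^+ 2 * `|g t|.
  by rewrite normrM mulrC ler_wpM2r// bspline_bound.
have is2 : mu.-integrable `]a, b[ (EFin \o (fun t => 64 * s ^+ 2 * `|g t|)).
  apply: (eq_integrable mab _ _ _ (integrableZl mab (64 * s ^+ 2) iag)) => t _ /=.
  by rewrite EFinM.
have igB : mu.-integrable `]a, b[ (EFin \o (fun t => g t * bspline e x s t)).
  apply: (le_integrable mab _ _ is2).
    apply/measurable_EFinP; apply: measurable_funM.
      by apply/measurable_EFinP; exact: measurable_int igab.
    exact: measurable_funS mB.
  by move=> t _ /=; rewrite lee_fin (le_trans (HB t))// ler_norm.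
apply: le_trans (le_normr_Rintegral mab igB) _.
rewrite -RintegralZl//; apply: le_Rintegral => //.
exact: (eq_integrable mab _ _ _ (integrable_abse igB)).
Qed.

Lemma diff3_bound T h g a b x s :
  {within `[0, T], continuous h} ->
  mu.-integrable `]0, T[ (EFin \o g) ->
  (forall phi, test_function T phi ->
    \int[mu]_(t in `]0, T[) (h t * derive1n 3 phi t) =
    - \int[mu]_(t in `]0, T[) (g t * phi t)) ->
  0 <= a -> a < x -> 0 < s -> x + 3 * s < b -> b <= T ->
  `|diff3 h x s| <= 64 * s ^+ 2 * \int[mu]_(t in `]a, b[) `|g t|.
Proof.
move=> ch ig weak a0 ax s0 xb bT.
apply/ler_addgt0Pr => d d0.
have [||r r0 Hr] := Rintegral_derive3_bspline T h x s d ch _ s0 _ d0; try lra.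
have m0 : 0 < Num.min r (Num.min s (b - (x + 3 * s))).
  by rewrite !lt_min r0 s0 subr_gt0.
pose e := Num.min r (Num.min s (b - (x + 3 * s))) / 2.
have e0 : 0 < e by rewrite divr_gt0.
have : e < Num.min r (Num.min s (b - (x + 3 * s))) by rewrite /e; clear -m0; lra.
rewrite !lt_min => /and3P[er es eb].
have := Hr e e0 er; rewrite weak; last first.
  by apply: test_bspline => //; clear -a0 ax eb bT; lra.
have := Rintegral_mul_bspline T g e a b x s ig e0 (ltW es) a0 ax.
move=> /(_ ltac:(clear -eb; lra) bT).
move: (Rintegral _ _ _) (64 * _ * _) => u v; clear.
move=> /ler_normlP[? ?] /ler_normlP[? ?].
by apply/ler_normlP; split; lra.
Qed.

End ThirdDifferenceBound.

(** * Square-integrable third derivatives *)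

Section ThirdDifferenceL2.
Context {R : realType}.
Notation mu := (@lebesgue_measure R).
Implicit Types (f h g : R -> R) (a b e p t x s T : R).

Lemma Rintegral_cst_oo a b (c : R) : a <= b ->
  \int[mu]_(t in `]a, b[) c = c * (b - a).
Proof.
move=> ab; rewrite Rintegral_cst//.
have -> : fine (mu `]a, b[%classic) = b - a; last by [].
rewrite lebesgue_measure_itv/= lte_fin.
by case: ltgtP ab => // -> _; rewrite subrr.
Qed.

Lemma Rintegral_Cauchy_Schwarz a b f : a < b ->
  mu.-integrable `]a, b[ (EFin \o f) ->
  mu.-integrable `]a, b[ (EFin \o (fun t => f t ^+ 2)) ->
  (\int[mu]_(t in `]a, b[) f t) ^+ 2 <=
    (b - a) * \int[mu]_(t in `]a, b[) (f t ^+ 2).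
Proof.
move=> ab i1 i2.
have mD : @measurable _ (measurableTypeR R) `]a, b[ by exact: measurable_itv.
have ic : mu.-integrable `]a, b[ (EFin \o cst (1 : R)).
  apply: (@integrableS _ (measurableTypeR R) _ _ `[a, b]) => //.
    exact: subset_itv_oo_cc.
  apply: continuous_compact_integrable; first exact: segment_compact.
  exact/continuous_subspaceT/cst_continuous.
pose A := \int[mu]_(t in `]a, b[) f t; pose Q := \int[mu]_(t in `]a, b[) (f t ^+ 2).
(* [l] is the mean of [f]; the integral of [(f - l)^2] is nonnegative and equals
   [Q - A^2 / (b - a)]. *)
pose l := A / (b - a).
have [ifc Efc] := Rintegral_comb _ _ _ (- (2 * l)) (l ^+ 2) mD i1 ic.
have [_ E] := Rintegral_comb _ _ _ 1 1 mD i2 ifc.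
have H : 0 <= \int[mu]_(t in `]a, b[)
    (1 * f t ^+ 2 + 1 * (- (2 * l) * f t + l ^+ 2 * cst 1 t)).
  apply: Rintegral_ge0 => t _.
  have -> : 1 * f t ^+ 2 + 1 * (- (2 * l) * f t + l ^+ 2 * cst 1 t) = (f t - l) ^+ 2.
    by rewrite /cst/=; ring.
  exact: sqr_ge0.
move: H; rewrite E Efc -/A -/Q (Rintegral_cst_oo _ _ _ (ltW ab)) !mul1r.
have ba : 0 < b - a by rewrite subr_gt0.
have -> : Q + (- (2 * l) * A + l ^+ 2 * (b - a)) = ((b - a) * Q - A ^+ 2) / (b - a).
  by rewrite /l; field; rewrite gt_eqF.
by rewrite pmulr_lge0 ?invr_gt0// subr_ge0.
Qed.

(** On a bounded interval [1 + G^2] is integrable, and it dominates [|G|]. *)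
Lemma integrable_L2_itv T g : g \_ `]0, T[ \in Lfun mu 2%:E ->
  mu.-integrable `]0, T[ (EFin \o g).
Proof.
move=> gL2; set G := g \_ `]0, T[.
have mD : @measurable _ (measurableTypeR R) `]0, T[ by exact: measurable_itv.
have iG2 := Lfun2_integrable_sqr gL2.
have mG : measurable_fun (setT : set (measurableTypeR R)) G.
  by move: gL2; rewrite inE => /andP[+ _]; rewrite inE.
have i1 : mu.-integrable `]0, T[ (EFin \o cst (1 : R)).
  apply: (@integrableS _ (measurableTypeR R) _ _ `[0, T]) => //.
    exact: subset_itv_oo_cc.
  apply: continuous_compact_integrable; first exact: segment_compact.
  exact/continuous_subspaceT/cst_continuous.
have iG2D : mu.-integrable `]0, T[ (EFin \o (fun t => G t ^+ 2)).
  by apply: integrableS iG2.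
have [iS _] := Rintegral_comb _ _ _ 1 1 mD i1 iG2D.
have iG : mu.-integrable `]0, T[ (EFin \o G).
  apply: (le_integrable mD _ _ iS).
    by apply/measurable_EFinP; exact: measurable_funS mG.
  move=> t _; rewrite /= !mul1r lee_fin (le_trans _ (ler_norm _))//.
  have : 0 <= (`|G t| - 1) ^+ 2 by exact: sqr_ge0.
  by rewrite -(real_normK (num_real (G t))); have := normr_ge0 (G t); nra.
by apply: (eq_integrable mD _ _ _ iG) => t tD; rewrite /= /G patchE tD.
Qed.

(** Cauchy-Schwarz trades the integral of [|g|] for that of its square at the cost of [b - a]. The
    half-open interval makes the latter an increment of a primitive. *)
Lemma diff3_sqr_bound T h g a b x s :
  {within `[0, T], continuous h} ->
  g \_ `]0, T[ \in Lfun mu 2%:E ->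
  (forall phi, test_function T phi ->
    \int[mu]_(t in `]0, T[) (h t * derive1n 3 phi t) =
    - \int[mu]_(t in `]0, T[) (g t * phi t)) ->
  0 <= a -> a < x -> 0 < s -> x + 3 * s < b -> b < T ->
  diff3 h x s ^+ 2 <= 64 ^+ 2 * s ^+ 4 * (b - a) *
    \int[mu]_(t in `]a, b]) ((g \_ `]0, T[) t ^+ 2).
Proof.
move=> ch gL2 weak a0 ax s0 xb bT.
have ig := integrable_L2_itv _ _ gL2.
have := diff3_bound _ _ _ _ _ _ _ ch ig weak a0 ax s0 xb (ltW bT).
set A := \int[mu]_(t in _) _ => HA.
have iG2 := Lfun2_integrable_sqr gL2.
have sD : `]a, b[ `<=` (`]0, T[ : set R).
  move=> t /=; rewrite !in_itv/= => /andP[t1 t2].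
  by apply/andP; split; [exact: le_lt_trans t1|exact: lt_trans bT].
have mab : @measurable _ (measurableTypeR R) `]a, b[ by exact: measurable_itv.
have igab : mu.-integrable `]a, b[ (EFin \o (fun t => `|g t|)).
  apply: (eq_integrable mab _ _ _ (integrable_abse (integrableS _ mab sD ig))) => //.
have iG2ab : mu.-integrable `]a, b[ (EFin \o (fun t => (g \_ `]0, T[) t ^+ 2)).
  exact: integrableS iG2.
have eG : {in `]a, b[%classic, (fun t => (g \_ `]0, T[) t ^+ 2) =1
    (fun t => `|g t| ^+ 2)}.
  move=> t tab; rewrite patchE ifT ?real_normK ?num_real//.
  by apply/mem_set/sD/set_mem.
have ig2 : mu.-integrable `]a, b[ (EFin \o (fun t => `|g t| ^+ 2)).
  by apply: (eq_integrable mab _ _ _ iG2ab) => t /eG/= ->.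
have ab : a < b by clear -ax s0 xb; lra.
have := Rintegral_Cauchy_Schwarz _ _ _ ab igab ig2; rewrite -/A.
have -> : \int[mu]_(t in `]a, b]) ((g \_ `]0, T[) t ^+ 2) =
    \int[mu]_(t in `]a, b[) (`|g t| ^+ 2).
  by rewrite -Rintegral_itv_bndo_bndc//; exact: eq_Rintegral.
set Q := \int[mu]_(t in _) _ => HQ.
have -> : 64 ^+ 2 * s ^+ 4 * (b - a) * Q = (64 * s ^+ 2) ^+ 2 * ((b - a) * Q) by ring.
apply: le_trans (ler_wpM2l (sqr_ge0 _) HQ).
rewrite -exprMn -(real_normK (num_real (diff3 _ _ _))).
by rewrite ler_sqr// nnegrE; exact: le_trans HA.
Qed.

(* [I] is, up to a constant, the primitive of the square of the weak third
   derivative. *)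
Lemma diff3_sqr_le T h g :
  {within `[0, T], continuous h} ->
  g \_ `]0, T[ \in Lfun mu 2%:E ->
  (forall phi, test_function T phi ->
    \int[mu]_(t in `]0, T[) (h t * derive1n 3 phi t) =
    - \int[mu]_(t in `]0, T[) (g t * phi t)) ->
  exists I : R -> R, (forall a b, 0 <= a -> a <= b -> I a <= I b) /\
    forall x s, 0 <= x -> 0 < s -> x + 3 * s <= T ->
      diff3 h x s ^+ 2 <= s ^+ 5 * (I (x + 3 * s) - I x).
Proof.
move=> ch gL2 weak.
have iG2 := Lfun2_integrable_sqr gL2.
pose F t := (g \_ `]0, T[) t ^+ 2.
(* The factor 3 absorbs the stencil length: [64^2 * s^4 * (b - a)] with [b - a <= 3 * s] is at most
   [K * s^5]. *)
have [K [K0 KE]] : exists K : R, 0 < K /\ K = 64 ^+ 2 * 3.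
  by exists (64 ^+ 2 * 3); split => //; rewrite mulr_gt0// exprn_gt0.
pose I t := K * \int[mu]_(u in `]0, t]) F u.
have IE a b : 0 <= a -> a <= b ->
    I b - I a = K * \int[mu]_(u in `]a, b]) F u.
  move=> a0 ab; rewrite -mulrBr; congr (_ * _).
  rewrite (@Rintegral_itvB R F (BRight 0) (BRight b) a) ?bnd_simp//.
  by apply: integrableS iG2.
have F0 a b : 0 <= \int[mu]_(u in `]a, b]) F u.
  by apply: Rintegral_ge0 => t _; exact: sqr_ge0.
have ndI a b : 0 <= a -> a <= b -> I a <= I b.
  by move=> a0 ab; rewrite -subr_ge0 IE//; exact: mulr_ge0 (ltW K0) (F0 _ _).
exists I; split => // x s x0 s0 xT.
have xs : x <= x + 3 * s by rewrite lerDl mulr_ge0// ltW.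
set B := s ^+ 5 * _.
have B0 : 0 <= B by rewrite mulr_ge0 ?exprn_ge0 ?subr_ge0 ?ndI// ltW.
(* The preceding bound needs a stencil with open room on both sides inside []0, T[]. Shrinking by
   multiples of [eta] provides it, and continuity of [h] at the four nodes then lets [eta] tend to
   0. *)
have sm eta : 0 < eta -> 4 * eta < s ->
    `|diff3 h (x + 2 * eta) (s - 2 * eta)| <= Num.sqrt B.
  move=> e0 es.
  have a0 : 0 <= x + eta by clear -x0 e0; lra.
  have ab : x + eta <= x + 3 * s - eta by clear -e0 es; lra.
  have := diff3_sqr_bound T h g (x + eta) (x + 3 * s - eta)
    (x + 2 * eta) (s - 2 * eta) ch gL2 weak a0.
  move=> /(_ ltac:(clear -e0; lra) ltac:(clear -e0 es; lra)).
  move=> /(_ ltac:(clear -e0 es; lra) ltac:(clear -e0 xT; lra)) H.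
  rewrite -sqrtr_sqr ler_wsqrtr//; apply: le_trans H _.
  rewrite -/F.
  have L : \int[mu]_(u in `]x + eta, x + 3 * s - eta]) F u <= (I (x + 3 * s) - I x) / K.
    rewrite ler_pdivlMr// mulrC -IE//; apply: lerB; apply: ndI => //.
    - exact: le_trans ab.
    - by clear -e0; lra.
    - by clear -e0; lra.
  apply: le_trans (ler_wpM2l _ L) _.
    by rewrite !mulr_ge0 ?exprn_ge0//; clear -e0 es; lra.
  rewrite /B; have : 0 <= I (x + 3 * s) - I x by rewrite subr_ge0 ndI.
  move: (I _ - I _) => D D0.
  have -> : 64 ^+ 2 * (s - 2 * eta) ^+ 4 * (x + 3 * s - eta - (x + eta)) * (D / K)
     = ((s - 2 * eta) ^+ 4 * ((3 * s - 2 * eta) / 3)) * D by rewrite KE; field.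
  apply: ler_wpM2r => //; rewrite (exprSr s 4); apply: ler_pM.
  - by rewrite exprn_ge0//; clear -e0 es; lra.
  - by clear -e0 es; lra.
  - by rewrite lerXn2r ?nnegrE//; clear -e0 es; lra.
  - by clear -e0; lra.
have : `|diff3 h x s| <= Num.sqrt B.
  apply/ler_addgt0Pr => d d0.
  have /within_continuousP cP := ch.
  have nh p : 0 <= p -> p <= T -> exists2 r, 0 < r & forall t, 0 <= t -> t <= T ->
      `|t - p| < r -> `|h t - h p| < d / 8.
    move=> p0 pT; have pI : `[0, T]%classic p by rewrite /= in_itv/= p0.
    have [|r r0 Hr] := cP p pI (d / 8); first by rewrite divr_gt0.
    by exists r => // t t0 tT; apply: Hr; rewrite /= in_itv/= t0.
  have [||r1 r10 H1] := nh x _ _; [clear -x0 s0 xT; lra..|].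
  have [||r2 r20 H2] := nh (x + s) _ _; [clear -x0 s0 xT; lra..|].
  have [||r3 r30 H3] := nh (x + 2 * s) _ _; [clear -x0 s0 xT; lra..|].
  have [||r4 r40 H4] := nh (x + 3 * s) _ _; [clear -x0 s0 xT; lra..|].
  pose m := Num.min s (Num.min (Num.min r1 r2) (Num.min r3 r4)).
  have m0 : 0 < m by rewrite !lt_min s0 r10 r20 r30.
  (* The nodes move by [2 * eta], 0, [-2 * eta] and [-4 * eta], which must all stay below the four
     radii. *)
  pose eta := m / 8.
  have e0 : 0 < eta by rewrite divr_gt0.
  have : 4 * eta < m by rewrite /eta; clear -m0; lra.
  rewrite !lt_min => /andP[es /andP[/andP[e1 e2] /andP[e3 e4]]].
  have := sm eta e0 es; move: (Num.sqrt B) => S.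
  have K1 : `|h (x + 2 * eta) - h x| < d / 8.
    apply: H1; [| |apply/ltr_normlP; split]; clear -x0 s0 xT e0 es e1; lra.
  have K2 : `|h (x + 2 * eta + (s - 2 * eta)) - h (x + s)| < d / 8.
    apply: H2; [| |apply/ltr_normlP; split]; clear -x0 s0 xT e0 es r20; lra.
  have K3 : `|h (x + 2 * eta + 2 * (s - 2 * eta)) - h (x + 2 * s)| < d / 8.
    apply: H3; [| |apply/ltr_normlP; split]; clear -x0 s0 xT e0 es e3; lra.
  have K4 : `|h (x + 2 * eta + 3 * (s - 2 * eta)) - h (x + 3 * s)| < d / 8.
    apply: H4; [| |apply/ltr_normlP; split]; clear -x0 s0 xT e0 es e4; lra.
  rewrite /diff3; move: K1 K2 K3 K4.
  move: (h (x + 2 * eta)) (h (x + 2 * eta + (s - 2 * eta)))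
    (h (x + 2 * eta + 2 * (s - 2 * eta))) (h (x + 2 * eta + 3 * (s - 2 * eta)))
    (h x) (h (x + s)) (h (x + 2 * s)) (h (x + 3 * s)) => y1 y2 y3 y4 z1 z2 z3 z4.
  clear; move=> /ltr_normlP[? ?] /ltr_normlP[? ?] /ltr_normlP[? ?].
  move=> /ltr_normlP[? ?] /ler_normlP[? ?].
  by apply/ler_normlP; split; lra.
rewrite -(real_normK (num_real (diff3 _ _ _))) -(ler_sqr _ _) ?nnegrE ?sqrtr_ge0//.
by rewrite sqr_sqrtr.
Qed.

End ThirdDifferenceL2.

(** * Consistency of the mid-point rule *)

Section FiniteDifferences.
Context {R : realType}.
Implicit Types (h dh I : R -> R) (a b c s t T : R).

(** Differentiability in a form without division, which makes sense at [t = c] too and is one-sided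
    at 0 and [T]. *)
Definition has_slope_on T h dh := forall c, 0 <= c -> c <= T ->
  forall e, 0 < e -> exists2 r, 0 < r & forall t, 0 <= t -> t <= T ->
    `|t - c| < r -> `|h t - h c - (t - c) * dh c| <= e * `|t - c|.

Lemma has_slope_continuous T h dh : has_slope_on T h dh ->
  {within `[0, T], continuous h}.
Proof.
move=> hd; apply/within_continuousP => c; rewrite /= in_itv/= => /andP[c0 cT] d d0.
have [r r0 Hr] := hd c c0 cT 1 ltr01.
have k0 : 0 < 1 + `|dh c| by rewrite ltr_pwDl.
exists (Num.min r (d / (1 + `|dh c|))); first by rewrite lt_min r0 divr_gt0.
move=> t; rewrite in_itv/= lt_min ltr_pdivlMr// => /andP[t0 tT] /andP[tr td].
have := Hr t t0 tT tr; have := normrM (t - c) (dh c).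
move: ((t - c) * dh c) => q Eq H; apply: le_lt_trans td.
have -> : h t - h c = (h t - h c - q) + q by rewrite subrK.
apply: le_trans (ler_normD _ _) _.
by rewrite mulrDr mulr1 -Eq lerD2r; rewrite mul1r in H.
Qed.

(** No uniform bound on [dh] is assumed, so the constant is tied to one point: near [c] the slope
    applies, and at distance at least [r] the increment, at most twice the maximum of [|h|], is
    compared with [r]. It serves at the endpoints 0 and [T]. *)
Lemma has_slope_lipschitz_at T h dh c : has_slope_on T h dh ->
  0 <= c -> c <= T ->
  exists2 B, 0 <= B & forall t, 0 <= t -> t <= T -> `|h t - h c| <= B * `|t - c|.
Proof.
move=> hd c0 cT; have ch := has_slope_continuous _ _ _ hd.
have T0 : 0 <= T by exact: le_trans cT.
have cN : {within `[0, T], continuous (fun t => `|h t|)}.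
  move=> t; apply: (@continuous_comp (subspace `[0, T]) R R h); first exact: ch.
  exact: norm_continuous.
have [m mT Hm] := EVT_max T0 cN.
have [r r0 Hr] := hd c c0 cT 1 ltr01.
have M0 : 0 <= 2 * `|h m| / r by rewrite divr_ge0 ?mulr_ge0// ltW.
exists (1 + `|dh c| + 2 * `|h m| / r) => [|t t0 tT]; first by rewrite !addr_ge0.
have [tr|tr] := ltP `|t - c| r.
  have := Hr t t0 tT tr; have := normrM (t - c) (dh c).
  move: ((t - c) * dh c) => q Eq H.
  have -> : h t - h c = (h t - h c - q) + q by rewrite subrK.
  apply: le_trans (ler_normD _ _) _.
  apply: (@le_trans _ _ ((1 + `|dh c|) * `|t - c|)).
    by rewrite mulrDl (mulrC `|dh c|) -Eq lerD2r.
  by rewrite ler_wpM2r// lerDl.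
apply: (@le_trans _ _ (2 * `|h m| / r * `|t - c|)); last first.
  by rewrite ler_wpM2r// lerDr addr_ge0.
apply: (@le_trans _ _ (2 * `|h m|)); last first.
  by rewrite -mulrA ler_peMr ?mulr_ge0// mulrC ler_pdivlMr// mul1r.
have hb u : 0 <= u -> u <= T -> `|h u| <= `|h m|.
  by move=> u0 uT; apply: Hm; rewrite in_itv/= u0.
apply: le_trans (ler_normB _ _) _.
by rewrite mulr_natl mulr2n lerD// hb.
Qed.

Lemma expr3_archi (s r : R) : 0 < r -> exists k : nat, s / 3 ^+ k < r.
Proof.
move=> r0; have [k Hk] : exists k : nat, s / r < k%:R.
  exists (Num.bound `|s / r|); apply: le_lt_trans (ler_norm _) _.
  exact: archi_boundP.
exists k; rewrite ltr_pdivrMr ?exprn_gt0//.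
rewrite mulrC -ltr_pdivrMr//; apply: lt_trans Hk _.
by rewrite -natrX ltr_nat ltn_expl.
Qed.

(* The central quotients for the increments s and s/3 differ by a third
   difference with step 2s/3, so those for s/3^k telescope. *)
Lemma central_diff_le T h dh I c s :
  has_slope_on T h dh ->
  (forall a b, 0 <= a -> a <= b -> I a <= I b) ->
  (forall x s, 0 <= x -> 0 < s -> x + 3 * s <= T ->
    diff3 h x s ^+ 2 <= s ^+ 5 * (I (x + 3 * s) - I x)) ->
  0 < s -> 0 <= c - s -> c + s <= T ->
  ((h (c + s) - h (c - s)) / (2 * s) - dh c) ^+ 2 <=
    4 * s ^+ 3 * (I (c + s) - I (c - s)).
Proof.
move=> hd ndI H3 s0 c0 cT.
pose D u := (h (c + u) - h (c - u)) / (2 * u).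
pose J := I (c + s) - I (c - s).
have J0 : 0 <= J by rewrite subr_ge0; apply: ndI => //; clear -s0; lra.
have sJ0 : 0 <= s ^+ 3 * J by rewrite mulr_ge0// exprn_ge0// ltW.
pose k := Num.sqrt (s ^+ 3 * J).
have k0 : 0 <= k by exact: sqrtr_ge0.
have k2 : k ^+ 2 = s ^+ 3 * J by rewrite sqr_sqrtr.
(* Here [(2 * u / 3)^5 / (2 * u)^2] is [8/243 * u^3], and the constant is rounded up to 1. *)
have step u : 0 < u -> u <= s -> (D u - D (u / 3)) ^+ 2 <= u ^+ 3 * J.
  move=> u0 us.
  have -> : D u - D (u / 3) = diff3 h (c - u) (2 * u / 3) / (2 * u).
    rewrite /D /diff3.
    have -> : c - u + 3 * (2 * u / 3) = c + u by field.
    have -> : c - u + 2 * (2 * u / 3) = c + u / 3 by field.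
    have -> : c - u + (2 * u / 3) = c - u / 3 by field.
    by field; rewrite gt_eqF.
  rewrite expr_div_n ler_pdivrMr; last by rewrite exprn_gt0// mulr_gt0.
  have := H3 (c - u) (2 * u / 3).
  have -> : c - u + 3 * (2 * u / 3) = c + u by field.
  move=> /(_ ltac:(clear -us c0; lra) ltac:(clear -u0; lra) ltac:(clear -us cT; lra)) H.
  apply: le_trans H _.
  have IJ : I (c + u) - I (c - u) <= J.
    by rewrite /J lerB//; apply: ndI; clear -us u0 c0 s0; lra.
  have u50 : 0 <= u ^+ 5 by rewrite exprn_ge0// ltW.
  apply: le_trans (ler_wpM2l _ IJ) _.
    by rewrite exprn_ge0// divr_ge0// mulr_ge0// ltW.
  have -> : u ^+ 3 * J * (2 * u) ^+ 2 = 4 * (u ^+ 5 * J) by ring.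
  have -> : (2 * u / 3) ^+ 5 * J = 32 / 243 * (u ^+ 5 * J) by field.
  have := mulr_ge0 u50 J0; move: (_ * J) => q; clear; lra.
(* At [u = s / 3^j] the increment is at most [k / 3^j], the exponent 3/2 being weakened to 1; the
   geometric sum [3/2 * (1 - 3^-n)] is rounded up to [2 * (1 - 3^-n)]. *)
have tel n : `|D s - D (s / 3 ^+ n)| <= 2 * k * (1 - (3 ^+ n)^-1).
  elim: n => [|n IH].
    by rewrite expr0 !divr1 invr1 !subrr normr0 mulr0.
  have p0 : 0 < (3 ^+ n : R)^-1 by rewrite invr_gt0 exprn_gt0.
  have p1 : (3 ^+ n : R)^-1 <= 1 by rewrite invf_le1 ?exprn_gt0// exprn_ege1// ler1n.
  have us : s / 3 ^+ n <= s by rewrite ler_piMr// ltW.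
  have St := step (s / 3 ^+ n) (mulr_gt0 s0 p0) us.
  have E : s / 3 ^+ n.+1 = s / 3 ^+ n / 3 by rewrite exprSr invfM mulrA.
  have S1 : `|D (s / 3 ^+ n) - D (s / 3 ^+ n.+1)| <= k / 3 ^+ n.
    rewrite E -ler_sqr ?nnegrE// ?divr_ge0 ?exprn_ge0// real_normK ?num_real//.
    apply: le_trans St _; rewrite !exprMn k2 mulrAC.
    rewrite ler_wpM2l// exprS ler_piMl ?exprn_ge0// ltW//.
  have -> : D s - D (s / 3 ^+ n.+1) =
    (D s - D (s / 3 ^+ n)) + (D (s / 3 ^+ n) - D (s / 3 ^+ n.+1)).
    by rewrite addrA subrK.
  apply: le_trans (ler_normD _ _) _.
  apply: le_trans (lerD IH S1) _.
  rewrite exprSr invfM; have := mulr_ge0 k0 (ltW p0).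
  by move: (3 ^+ n)^-1 => p; clear; lra.
have lim d : 0 < d -> exists n, `|D (s / 3 ^+ n) - dh c| <= d.
  move=> d0; have [||r r0 Hr] := hd c _ _ d d0; [clear -s0 c0 cT; lra..|].
  have [n Hn] := expr3_archi s r r0; exists n.
  have p0 : 0 < (3 ^+ n : R)^-1 by rewrite invr_gt0 exprn_gt0.
  have p1 : (3 ^+ n : R)^-1 <= 1 by rewrite invf_le1 ?exprn_gt0// exprn_ege1// ler1n.
  have u0 : 0 < s / 3 ^+ n by exact: mulr_gt0.
  have us : s / 3 ^+ n <= s by rewrite ler_piMr// ltW.
  rewrite /D; move: (s / 3 ^+ n) u0 us Hn => u u0 us ur.
  have E1 : c + u - c = u by ring.
  have E2 : c - u - c = - u by ring.
  have := Hr (c + u); have := Hr (c - u); rewrite E1 E2 normrN (gtr0_norm u0).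
  move=> /(_ ltac:(clear -us c0; lra) ltac:(clear -u0 s0 cT; lra) ur) /ler_normlP[A1 A2].
  move=> /(_ ltac:(clear -u0 s0 c0; lra) ltac:(clear -us cT; lra) ur) /ler_normlP[B1 B2].
  have -> : (h (c + u) - h (c - u)) / (2 * u) - dh c =
     (h (c + u) - h (c - u) - 2 * u * dh c) / (2 * u) by field; rewrite gt_eqF.
  rewrite normrM normfV (gtr0_norm (_ : 0 < 2 * u)) ?mulr_gt0//.
  rewrite ler_pdivrMr ?mulr_gt0//; apply/ler_normlP.
  by move: A1 A2 B1 B2; clear; split; lra.
have fin : `|D s - dh c| <= 2 * k.
  apply/ler_addgt0Pr => d d0; have [n Hn] := lim d d0.
  have -> : D s - dh c = (D s - D (s / 3 ^+ n)) + (D (s / 3 ^+ n) - dh c).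
    by rewrite addrA subrK.
  apply: le_trans (ler_normD _ _) _; apply: lerD => //.
  apply: le_trans (tel n) _.
  by rewrite ler_piMr ?mulr_ge0// gerBl invr_ge0 exprn_ge0.
rewrite -/(D s) -(real_normK (num_real _)).
have -> : 4 * s ^+ 3 * (I (c + s) - I (c - s)) = (2 * k) ^+ 2.
  by rewrite exprMn k2 /J; ring.
by rewrite ler_sqr// nnegrE mulr_ge0.
Qed.

End FiniteDifferences.

Section SecondDifference.
Context {R : realType}.
Implicit Types (h dh I : R -> R) (a b c s t T : R).

Definition diff2 h s (k : nat) :=
  h (k.+2%:R * s) - 2 * h (k.+1%:R * s) + h (k%:R * s).

(* Third differences make all second differences on one grid close to each
   other, and their sum telescopes to two first differences. *)
Lemma diff2_le T h dh I : 0 < T ->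
  has_slope_on T h dh ->
  (forall a b, 0 <= a -> a <= b -> I a <= I b) ->
  (forall x s, 0 <= x -> 0 < s -> x + 3 * s <= T ->
    diff3 h x s ^+ 2 <= s ^+ 5 * (I (x + 3 * s) - I x)) ->
  exists2 C, 0 <= C & forall (N : nat) s (k : nat), N%:R * s = T ->
    (k.+2 <= N)%N -> `|diff2 h s k| <= C * s ^+ 2.
Proof.
move=> T0 hd ndI H3.
have [B0 B00 HB0] := has_slope_lipschitz_at _ _ _ _ hd (lexx 0) (ltW T0).
have [B1 B10 HB1] := has_slope_lipschitz_at _ _ _ _ hd (ltW T0) (lexx T).
(* [V * s^2] bounds the variation of the potential [P] below: [k * s] stays in [[0, T]], and each of
   the three values of [I] varies by at most [I T - I 0]. *)
pose V := (T + 3 * (I T - I 0)) / 2.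
have I0 : 0 <= I T - I 0 by rewrite subr_ge0 ndI// ltW.
have V0 : 0 <= V by rewrite /V; clear -T0 I0; lra.
have C0 : 0 <= V + 2 * (B0 + B1) / T.
  apply: addr_ge0 => //; apply: divr_ge0; last exact: ltW.
  by rewrite mulr_ge0// addr_ge0.
exists (V + 2 * (B0 + B1) / T) => // N s k0 NT k0N.
have N0 : (0 < N)%N by exact: leq_trans k0N.
have s0 : 0 < s.
  have : 0 < N%:R * s by rewrite NT.
  by rewrite pmulr_rgt0// ltr0n.
have gridT j : (j <= N)%N -> 0 <= j%:R * s <= T.
  move=> jN; apply/andP; split; first by rewrite mulr_ge0// ltW.
  by rewrite -NT ler_pM2r// ler_nat.
(* A third difference is at most [s^2 * sqrt (s * J)], hence [s^2 * (s + J) / 2], where [J] is the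
   increase of [I] over three cells. Summing three consecutive values of [I] turns [J] into a
   one-step increment of [P]. *)
pose P (k : nat) := s ^+ 2 *
  (k%:R * s + I (k%:R * s) + I (k.+1%:R * s) + I (k.+2%:R * s)) / 2.
have stepP k : (k.+3 <= N)%N -> `|diff2 h s k.+1 - diff2 h s k| <= P k.+1 - P k.
  move=> kN; have /andP[k30 k3T] := gridT _ kN.
  have E3 : k%:R * s + 3 * s = k.+3%:R * s by rewrite -mulrDl -natrD addn3.
  have E2 : k%:R * s + 2 * s = k.+2%:R * s by rewrite -mulrDl -natrD addn2.
  have E1 : k%:R * s + s = k.+1%:R * s by rewrite -natr1 mulrDl mul1r.
  have -> : diff2 h s k.+1 - diff2 h s k = diff3 h (k%:R * s) s.
    by rewrite /diff2 /diff3 E1 E2 E3; ring.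
  have ks0 : 0 <= k%:R * s by rewrite mulr_ge0// ltW.
  have := H3 (k%:R * s) s ks0 s0; rewrite E3 => /(_ k3T).
  have J0 : 0 <= I (k.+3%:R * s) - I (k%:R * s).
    by rewrite subr_ge0 ndI// -E3 lerDl mulr_ge0// ltW.
  have -> : P k.+1 - P k = s ^+ 2 * ((s + (I (k.+3%:R * s) - I (k%:R * s))) / 2).
    by rewrite /P -E1; field.
  move: J0; move: (I _ - I _) => J J0 H.
  rewrite -ler_sqr ?nnegrE//; last first.
    by rewrite mulr_ge0 ?sqr_ge0// divr_ge0// addr_ge0// ltW.
  rewrite real_normK ?num_real//; apply: le_trans H _.
  have -> : s ^+ 5 * J = s ^+ 4 * (s * J) by ring.
  rewrite exprMn -exprM; apply: ler_wpM2l; first by rewrite exprn_ge0// ltW.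
  have := sqr_ge0 (s - J); clear; move=> H.
  have -> : ((s + J) / 2) ^+ 2 = s * J + (s - J) ^+ 2 / 4 by field.
  by lra.
have farP j i : ((j + i).+2 <= N)%N ->
    `|diff2 h s (j + i)%N - diff2 h s j| <= P (j + i)%N - P j.
  elim: i => [|i IH]; first by rewrite addn0 !subrr normr0.
  rewrite addnS => jN; have := IH (ltnW jN); have := stepP _ jN.
  move: (diff2 _ _ _) (diff2 _ _ _) (diff2 _ _ _) (P _) (P _) (P _).
  clear; move=> a b c d e f /ler_normlP[? ?] /ler_normlP[? ?].
  by apply/ler_normlP; split; lra.
have rangeP i j : (i.+2 <= N)%N -> (j.+2 <= N)%N -> P j - P i <= V * s ^+ 2.
  move=> iN jN.
  have Ib k : (k <= N)%N -> I 0 <= I (k%:R * s) <= I T.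
    by move=> /gridT/andP[? ?]; rewrite !ndI.
  have /andP[i1 i1'] := Ib i (ltnW (ltnW iN)); have /andP[i2 i2'] := Ib i.+1 (ltnW iN).
  have /andP[i3 i3'] := Ib i.+2 iN.
  have /andP[j1 j1'] := Ib j (ltnW (ltnW jN)); have /andP[j2 j2'] := Ib j.+1 (ltnW jN).
  have /andP[j3 j3'] := Ib j.+2 jN.
  have /andP[g1 g2] := gridT _ (ltnW (ltnW iN)).
  have /andP[g3 g4] := gridT _ (ltnW (ltnW jN)).
  rewrite /P /V; set s2 := s ^+ 2; have s20 : 0 <= s2 by exact: sqr_ge0.
  rewrite -mulrBl (mulrC _ s2) -mulrBr -mulrA; apply: ler_wpM2l => //.
  rewrite ler_pM2r//.
  by clear -i1 i1' i2 i2' i3 i3' j1 j1' j2 j2' j3 j3' g1 g2 g3 g4; lra.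
have close j : (j.+2 <= N)%N -> `|diff2 h s k0 - diff2 h s j| <= V * s ^+ 2.
  move=> jN; have [jk|kj] := leqP j k0.
    apply: le_trans (rangeP j k0 jN k0N).
    by rewrite -(subnKC jk) farP// subnKC.
  rewrite distrC; apply: le_trans (rangeP k0 j k0N jN).
  by rewrite -(subnKC (ltnW kj)) farP// subnKC// ltnW.
have tel M : \sum_(j < M) diff2 h s j =
    h (M.+1%:R * s) - h (M%:R * s) - (h (1%:R * s) - h (0%:R * s)).
  elim: M => [|M IH]; first by rewrite big_ord0 subrr.
  by rewrite big_ord_recr /= IH /diff2; ring.
case: N NT N0 k0N gridT stepP farP rangeP close => [//|[//|M]] NT _ k0N gridT _ _ _ close.
(* With [M.+2] cells there are [M.+1] second differences; their sum is the last first difference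
   minus the initial one, controlled at [T] and at 0. *)
have S1 : `|\sum_(j < M.+1) diff2 h s j| <= (B0 + B1) * s.
  rewrite tel NT mul1r mul0r.
  have /andP[g1 g2] := gridT 1%N isT; rewrite mul1r in g1 g2.
  have := HB0 s g1 g2; rewrite subr0 (gtr0_norm s0) => K1.
  have /andP[g3 g4] := gridT M.+1 (leqnSn _).
  have E : M.+1%:R * s - T = - s.
    by rewrite -NT -[M.+2%:R]natr1 mulrDl mul1r opprD addrA subrr add0r.
  have := HB1 _ g3 g4; rewrite E normrN (gtr0_norm s0).
  move: K1; clear; move: (h _) (h _) (h _) (h _) => a b c d.
  by move=> /ler_normlP[? ?] /ler_normlP[? ?]; apply/ler_normlP; split; lra.
have S2 : `|M.+1%:R * diff2 h s k0 - \sum_(j < M.+1) diff2 h s j| <= M.+1%:R * (V * s ^+ 2).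
  have -> : M.+1%:R * diff2 h s k0 = \sum_(j < M.+1) diff2 h s k0.
    by rewrite sumr_const card_ord mulr_natl.
  rewrite -sumrB; apply: le_trans (ler_norm_sum _ _ _) _.
  have -> : M.+1%:R * (V * s ^+ 2) = \sum_(j < M.+1) (V * s ^+ 2).
    by rewrite sumr_const card_ord mulr_natl.
  by apply: ler_sum => j _; apply: close; rewrite !ltnS -ltnS.
have M0 : 0 < M.+1%:R :> R by rewrite ltr0n.
have TM : T <= 2 * (M.+1%:R * s).
  rewrite -NT mulrA ler_pM2r// -natrM ler_nat.
  by rewrite mul2n -addnn addSn ltnS leq_addl.
have : M.+1%:R * `|diff2 h s k0| <= (B0 + B1) * s + M.+1%:R * (V * s ^+ 2).
  rewrite -(gtr0_norm M0) -normrM (gtr0_norm M0).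
  apply: le_trans (lerD S1 S2).
  by apply: le_trans (ler_normD _ _); rewrite addrC subrK.
(* Averaging over [M.+1] terms gains [1 / M.+1 <= 2 * s / T], which supplies the second factor
   [s]. *)
have BT : (B0 + B1) * s <= M.+1%:R * (2 * (B0 + B1) / T * s ^+ 2).
  have -> : M.+1%:R * (2 * (B0 + B1) / T * s ^+ 2) =
     (B0 + B1) * s * (2 * (M.+1%:R * s) / T) by field; rewrite gt_eqF.
  rewrite ler_peMr//; first by rewrite mulr_ge0 ?addr_ge0// ltW.
  by rewrite ler_pdivlMr// mul1r.
move=> H; rewrite -(ler_pM2l M0); apply: le_trans H _.
by rewrite (mulrDl V) mulrDr addrC lerD2l.
Qed.

End SecondDifference.

Section Consistency.
Context {R : realType}.

Lemma has_derivative_on_coord m (T : R) (y dy : R -> 'cV[R]_m) (i : 'I_m) :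
  has_derivative_on T y dy ->
  has_slope_on T (fun t => y t i 0) (fun t => dy t i 0).
Proof.
move=> yd c c0 cT e e0.
have cI : c \in `[0, T] by rewrite in_itv/= c0.
have H := cvg_comp _ _ (yd c cI) (@coord_continuous _ _ _ i 0 (dy c)).
move/cvgrPdist_le : H => /(_ e e0).
case=> r /= r0 Hr; exists r => // t t0 tT tr.
have [->|tc] := eqVneq t c; first by rewrite !subrr mul0r subrr normr0 mulr0.
have := Hr t; rewrite /= distrC => /(_ tr tc).
rewrite in_itv/= t0 tT => /(_ isT); rewrite !mxE distrC.
have tc0 : t - c != 0 by rewrite subr_eq0.
have -> : y t i 0 - y c i 0 - (t - c) * dy c i 0 =
   ((t - c)^-1 * (y t i 0 - y c i 0) - dy c i 0) * (t - c) by field.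
by rewrite normrM; apply: ler_wpM2r.
Qed.

(** The averaging error is half a second difference with step [dt / 2], so [diff2_le] on the grid
    with [2 * N] cells bounds it uniformly. The quotient error falls under [central_diff_le] with
    [s = dt / 2], and the increments of [I] telescope over the cells. *)
Lemma scalar_midpoint_consistency (T : R) (h dh g : R -> R) : 0 < T ->
  has_slope_on T h dh ->
  g \_ `]0, T[ \in Lfun (@lebesgue_measure R) 2%:E ->
  (forall phi, test_function T phi ->
    \int[lebesgue_measure]_(t in `]0, T[) (h t * derive1n 3 phi t) =
    - \int[lebesgue_measure]_(t in `]0, T[) (g t * phi t)) ->
  exists2 C, 0 <= C & forall (N : nat) dt, (0 < N)%N -> N%:R * dt = T ->
    \sum_(j < N) dt * (2^-1 * (h (tgrid dt j.+1) + h (tgrid dt j))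
       - h (tgrid dt j.+1 - dt / 2)) ^+ 2 <= C * dt ^+ 4 /\
    \sum_(j < N) dt * (dt^-1 * (h (tgrid dt j.+1) - h (tgrid dt j))
       - dh (tgrid dt j.+1 - dt / 2)) ^+ 2 <= C * dt ^+ 4.
Proof.
move=> T0 hd gL2 weak; have ch := has_slope_continuous _ _ _ hd.
have [I [ndI H3]] := diff3_sqr_le _ _ _ ch gL2 weak.
have [C C0 HC] := diff2_le _ _ _ _ T0 hd ndI H3.
have IT0 : 0 <= I T - I 0 by rewrite subr_ge0 ndI// ltW.
exists (T * C ^+ 2 + (I T - I 0)).
  by rewrite addr_ge0// mulr_ge0 ?sqr_ge0// ltW.
move=> N dt N0 NT.
have dt0 : 0 < dt.
  have : 0 < N%:R * dt by rewrite NT.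
  by rewrite pmulr_rgt0// ltr0n.
have d4 : 0 <= dt ^+ 4 by rewrite exprn_ge0// ltW.
split.
- have B (j : 'I_N) : dt * (2^-1 * (h (tgrid dt j.+1) + h (tgrid dt j))
       - h (tgrid dt j.+1 - dt / 2)) ^+ 2 <= dt * (C ^+ 2 * dt ^+ 4).
    rewrite ler_pM2l//.
    have E2 : (N * 2)%:R * (dt / 2) = T by rewrite natrM -NT; field.
    have := HC _ (dt / 2) (j * 2)%N E2.
    have jN : ((j * 2).+2 <= N * 2)%N by rewrite -[_.+2]/(j.+1 * 2)%N leq_mul2r ltn_ord.
    move=> /(_ jN); rewrite /diff2.
    have -> : (j * 2).+2%:R * (dt / 2) = tgrid dt j.+1.
      by rewrite -[(j * 2).+2]/(j.+1 * 2)%N natrM /tgrid; field.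
    have -> : (j * 2).+1%:R * (dt / 2) = tgrid dt j.+1 - dt / 2.
      by rewrite /tgrid -!natr1 natrM; field.
    have -> : (j * 2)%:R * (dt / 2) = tgrid dt j by rewrite /tgrid natrM; field.
    move: (h _) (h _) (h _) => c b a H.
    have -> : (2^-1 * (a + c) - b) ^+ 2 = (a - 2 * b + c) ^+ 2 / 4 by field.
    have : (a - 2 * b + c) ^+ 2 <= (C * (dt / 2) ^+ 2) ^+ 2.
      rewrite -(real_normK (num_real (a - _ + _))) ler_sqr// nnegrE.
      exact: le_trans H.
    have -> : (C * (dt / 2) ^+ 2) ^+ 2 = C ^+ 2 * dt ^+ 4 / 16 by field.
    have := mulr_ge0 (sqr_ge0 C) d4; move=> P1 P2; clear -P1 P2; lra.
  apply: le_trans (ler_sum _ (fun j _ => B j)) _.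
  by rewrite sumr_const card_ord -mulr_natl mulrA NT mulrA mulrDl lerDl mulr_ge0.
- have B (j : 'I_N) : dt * (dt^-1 * (h (tgrid dt j.+1) - h (tgrid dt j))
       - dh (tgrid dt j.+1 - dt / 2)) ^+ 2
      <= dt ^+ 4 * (I (tgrid dt j.+1) - I (tgrid dt j)).
    have E1 : tgrid dt j.+1 - dt / 2 + dt / 2 = tgrid dt j.+1 by rewrite subrK.
    have E2 : tgrid dt j.+1 - dt / 2 - dt / 2 = tgrid dt j.
      by rewrite /tgrid -natr1; field.
    have g0 : 0 <= tgrid dt j by rewrite mulr_ge0// ltW.
    have gT : tgrid dt j.+1 <= T by rewrite /tgrid -NT ler_pM2r// ler_nat.
    have IJ : 0 <= I (tgrid dt j.+1) - I (tgrid dt j).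
      by rewrite subr_ge0 ndI// /tgrid ler_pM2r// ler_nat.
    have := central_diff_le _ _ _ _ (tgrid dt j.+1 - dt / 2) (dt / 2) hd ndI H3.
    rewrite E1 E2 => /(_ (divr_gt0 dt0 (ltr0n _ 2)) g0 gT).
    have -> : 2 * (dt / 2) = dt by field.
    rewrite (mulrC _ dt^-1); move: (_ - dh _) => q H.
    have := ler_wpM2l (ltW dt0) H; move: IJ; move: (I _ - I _) => J J0.
    have -> : dt * (4 * (dt / 2) ^+ 3 * J) = dt ^+ 4 * J / 2 by field.
    have := mulr_ge0 d4 J0; move=> P1 P2; clear -P1 P2; lra.
  apply: le_trans (ler_sum _ (fun j _ => B j)) _.
  rewrite -mulr_sumr.
  have -> : \sum_(j < N) (I (tgrid dt j.+1) - I (tgrid dt j)) = I T - I 0.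
    have -> : I T - I 0 = I (tgrid dt N) - I (tgrid dt 0).
      by rewrite /tgrid NT mul0r.
    elim: N {N0 NT B} => [|N IH]; first by rewrite big_ord0 subrr.
    by rewrite big_ord_recr /= IH; ring.
  by rewrite mulrC ler_wpM2r// lerDr mulr_ge0 ?sqr_ge0// ltW.
Qed.

End Consistency.

(** * The weighted space and the POD projection *)

Section WeightedNorm.
Context {R : realType} {m : nat} {W : 'M[R]_m}.
Context (Wdiag : is_diag_mx W) (Wpos : forall i : 'I_m, 0 < W i i).
Implicit Types (u v w : 'cV[R]_m) (A : 'M[R]_m).

Lemma wdotE u v : wdot W u v = \sum_i W i i * (u i 0 * v i 0).
Proof.
rewrite /wdot mxE; apply: eq_bigr => i _; rewrite mxE (bigD1 i)//= big1 ?addr0.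
  by rewrite !mxE (mulrC (u i 0)) mulrA.
by move=> j ji; rewrite (is_diag_mxP Wdiag) ?mulr0.
Qed.

Lemma wdotC u v : wdot W u v = wdot W v u.
Proof. by rewrite !wdotE; apply: eq_bigr => i _; rewrite (mulrC (u i 0)). Qed.

Lemma wdotDl u v w : wdot W (u + v) w = wdot W u w + wdot W v w.
Proof.
by rewrite !wdotE -big_split; apply: eq_bigr => i _; rewrite !mxE /=; ring.
Qed.

Lemma wdotZl (a : R) u w : wdot W (a *: u) w = a * wdot W u w.
Proof.
by rewrite !wdotE mulr_sumr; apply: eq_bigr => i _; rewrite !mxE /=; ring.
Qed.

Lemma wdotNl u w : wdot W (- u) w = - wdot W u w.
Proof. by rewrite -scaleN1r wdotZl mulN1r. Qed.

Lemma wdotBl u v w : wdot W (u - v) w = wdot W u w - wdot W v w.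
Proof. by rewrite wdotDl wdotNl. Qed.

Lemma wdotDr u v w : wdot W w (u + v) = wdot W w u + wdot W w v.
Proof. by rewrite wdotC wdotDl !(wdotC w). Qed.

Lemma wdotZr (a : R) u w : wdot W w (a *: u) = a * wdot W w u.
Proof. by rewrite wdotC wdotZl (wdotC w). Qed.

Lemma wdotBr u v w : wdot W w (u - v) = wdot W w u - wdot W w v.
Proof. by rewrite wdotC wdotBl !(wdotC w). Qed.

Lemma wdot_suml (I : Type) (r : seq I) (P : pred I) (F : I -> 'cV[R]_m) w :
  wdot W (\sum_(i <- r | P i) F i) w = \sum_(i <- r | P i) wdot W (F i) w.
Proof.
elim/big_rec2: _ => [|i a b _ <-]; last by rewrite wdotDl.
by rewrite wdotE big1// => i _; rewrite mxE mul0r mulr0.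
Qed.

Lemma wdot_sumr (I : Type) (r : seq I) (P : pred I) (F : I -> 'cV[R]_m) w :
  wdot W w (\sum_(i <- r | P i) F i) = \sum_(i <- r | P i) wdot W w (F i).
Proof. by rewrite wdotC wdot_suml; apply: eq_bigr => i _; rewrite wdotC. Qed.

Lemma wdot_ge0 u : 0 <= wdot W u u.
Proof.
rewrite wdotE sumr_ge0// => i _; rewrite mulr_ge0 ?(ltW (Wpos i))//.
by rewrite -expr2 sqr_ge0.
Qed.

Lemma wnorm_ge0 u : 0 <= wnorm W u.
Proof. exact: sqrtr_ge0. Qed.

Lemma wnorm_sqr u : wnorm W u ^+ 2 = wdot W u u.
Proof. by rewrite sqr_sqrtr// wdot_ge0. Qed.

Lemma wnorm_sqrE u : wnorm W u ^+ 2 = \sum_i W i i * u i 0 ^+ 2.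
Proof. by rewrite wnorm_sqr wdotE; apply: eq_bigr => i _; rewrite expr2. Qed.

Lemma wnorm0_eq0 u : wnorm W u = 0 -> u = 0.
Proof.
move=> u0; have : wnorm W u ^+ 2 = 0 by rewrite u0 expr0n.
rewrite wnorm_sqrE => /eqP; rewrite psumr_eq0; last first.
  by move=> i _; rewrite mulr_ge0 ?sqr_ge0// ltW.
move=> /allP H; apply/matrixP => i j; rewrite ord1 mxE.
have := H i (mem_index_enum i); rewrite mulf_eq0 gt_eqF//= sqrf_eq0.
by move=> /eqP.
Qed.

Lemma wnorm0 : wnorm W 0 = 0.
Proof.
by rewrite /wnorm wdotE big1 ?sqrtr0// => i _; rewrite mxE mul0r mulr0.
Qed.

(** Cauchy-Schwarz: the squared norm of [|v| u - |u| v] is [2 |u| |v|] times the gap between the two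
    sides. *)
Lemma wdot_le u v : wdot W u v <= wnorm W u * wnorm W v.
Proof.
have [u0|u0] := eqVneq (wnorm W u) 0.
  by rewrite u0 (wnorm0_eq0 _ u0) wdotE big1 ?mul0r// => i _; rewrite mxE mul0r mulr0.
have [v0|v0] := eqVneq (wnorm W v) 0.
  by rewrite v0 (wnorm0_eq0 _ v0) wdotE big1 ?mulr0// => i _; rewrite mxE !mulr0.
have up : 0 < wnorm W u by rewrite lt_neqAle eq_sym u0 wnorm_ge0.
have vp : 0 < wnorm W v by rewrite lt_neqAle eq_sym v0 wnorm_ge0.
have := wdot_ge0 (wnorm W v *: u - wnorm W u *: v).
rewrite wdotBl !wdotBr !wdotZl !wdotZr -!wnorm_sqr (wdotC v u).
move: up vp; move: (wnorm W u) (wnorm W v) (wdot W u v) => a b c a0 b0.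
have -> : b * (b * a ^+ 2) - b * (a * c) - (a * (b * c) - a * (a * b ^+ 2)) =
   2 * (a * b) * (a * b - c) by ring.
by rewrite pmulr_rge0 ?subr_ge0// !mulr_gt0.
Qed.

Lemma wnormD u v : wnorm W (u + v) <= wnorm W u + wnorm W v.
Proof.
rewrite -ler_sqr ?nnegrE ?addr_ge0 ?wnorm_ge0//.
rewrite wnorm_sqr wdotDl !wdotDr (wdotC v u) -!wnorm_sqr sqrrD.
have := wdot_le u v; move: (wdot _ _ _) (_ * _) => a b; rewrite mulr2n; lra.
Qed.

Lemma wnormZ (a : R) u : wnorm W (a *: u) = `|a| * wnorm W u.
Proof.
by rewrite /wnorm wdotZl wdotZr mulrA -expr2 sqrtrM ?sqr_ge0// sqrtr_sqr.
Qed.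

Lemma wnormN u : wnorm W (- u) = wnorm W u.
Proof. by rewrite -scaleN1r wnormZ normrN1 mul1r. Qed.

Lemma wnorm_sum (I : Type) (r : seq I) (P : pred I) (F : I -> 'cV[R]_m) :
  wnorm W (\sum_(i <- r | P i) F i) <= \sum_(i <- r | P i) wnorm W (F i).
Proof.
elim/big_rec2: _ => [|i a b _ H]; first by rewrite wnorm0.
by apply: le_trans (wnormD _ _) _; rewrite lerD2l.
Qed.

Lemma wnorm_sqrD u v :
  wnorm W (u + v) ^+ 2 <= 2 * (wnorm W u ^+ 2 + wnorm W v ^+ 2).
Proof.
have := wnormD u v; rewrite -ler_sqr ?nnegrE ?addr_ge0 ?wnorm_ge0// => H.
apply: le_trans H _; have := sqr_ge0 (wnorm W u - wnorm W v).
by move: (wnorm W u) (wnorm W v) => a b; rewrite sqrrB sqrrD !mulr2n; lra.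
Qed.

Lemma coord_le_wnorm u i : `|u i 0| <= wnorm W u / Num.sqrt (W i i).
Proof.
rewrite ler_pdivlMr ?sqrtr_gt0// -ler_sqr ?nnegrE ?mulr_ge0 ?wnorm_ge0 ?sqrtr_ge0//.
rewrite exprMn sqr_sqrtr ?(ltW (Wpos i))// real_normK ?num_real// wnorm_sqrE.
rewrite (bigD1 i)//= mulrC lerDl sumr_ge0// => j _.
by rewrite mulr_ge0 ?sqr_ge0// ltW.
Qed.

(** Boundedness is what gives the [sup] in [wopnorm] its meaning. Vectors of the unit ball have
    coordinates at most [1 / sqrt (W j j)], so combinations of the columns of [A] stay bounded. *)
Lemma wopnorm_has_ubound A :
  has_ubound [set wnorm W (A *m u) | u in [set u | wnorm W u <= 1]].
Proof.
exists (\sum_j wnorm W (col j A) / Num.sqrt (W j j)) => _ [u /= u1 <-].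
have -> : A *m u = \sum_j u j 0 *: col j A.
  apply/matrixP => i k; rewrite ord1 summxE mxE; apply: eq_bigr => j _.
  by rewrite !mxE mulrC.
apply: le_trans (wnorm_sum _ _ _ _) _; apply: ler_sum => j _.
rewrite wnormZ mulrC ler_wpM2l ?wnorm_ge0//.
apply: le_trans (coord_le_wnorm u j) _.
by rewrite ler_pdivrMr ?sqrtr_gt0// mulVf// gt_eqF// sqrtr_gt0.
Qed.

Lemma wopnorm_ge0 A : 0 <= wopnorm W A.
Proof.
apply: le_trans (sup_upper_bound _ _); last first.
- by exists 0 => //=; rewrite wnorm0 ler01.
- split; last exact: wopnorm_has_ubound.
  by exists (wnorm W (A *m 0)), 0 => //=; rewrite wnorm0 ler01.
- exact: wnorm_ge0.
Qed.

Lemma wnorm_mulmx A u : wnorm W (A *m u) <= wopnorm W A * wnorm W u.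
Proof.
have [u0|u0] := eqVneq (wnorm W u) 0.
  by rewrite u0 (wnorm0_eq0 _ u0) mulmx0 wnorm0 mulr0.
have up : 0 < wnorm W u by rewrite lt_neqAle eq_sym u0 wnorm_ge0.
rewrite -ler_pdivrMr// -[X in _ / X]gtr0_norm// -normfV mulrC -wnormZ scalemxAr.
apply: sup_upper_bound.
  split; last exact: wopnorm_has_ubound.
  by exists (wnorm W (A *m 0)), 0 => //=; rewrite wnorm0 ler01.
by exists ((wnorm W u)^-1 *: u) => //=; rewrite wnormZ normfV gtr0_norm// mulVf.
Qed.

End WeightedNorm.

Section ProperOrthogonalDecomposition.
Context {R : realType} {m : nat} {W : 'M[R]_m}.
Context (Wdiag : is_diag_mx W) (Wpos : forall i : 'I_m, 0 < W i i).
Implicit Types (u v w : 'cV[R]_m).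

Definition pod_proj {d} (Psi : 'M[R]_(m, d)) (l : nat) v : 'cV[R]_m :=
  \sum_(i < d | (i < l)%N) wdot W v (col i Psi) *: col i Psi.

Lemma pod_proj_in d (Psi : 'M[R]_(m, d)) (l : nat) v :
  pod_proj Psi l v \in pod_space Psi l.
Proof.
apply: rpred_sum => i il; apply: rpredZ; apply: memv_span.
by apply/mapP; exists i => //; rewrite mem_filter il mem_enum.
Qed.

Lemma pod_space_orth d (Psi : 'M[R]_(m, d)) (l : nat) v w :
  (forall i : 'I_d, (i < l)%N -> wdot W w (col i Psi) = 0) ->
  v \in pod_space Psi l -> wdot W w v = 0.
Proof.
move=> H; rewrite /pod_space; set s := [seq _ | _ <- _].
move=> vs; rewrite (coord_span (vs : v \in <<in_tuple s>>%VS)).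
rewrite (wdot_sumr Wdiag) big1// => k _; rewrite (wdotZr Wdiag).
have : (in_tuple s)`_k \in s by apply: mem_nth; rewrite ltn_ord.
by case/mapP => i; rewrite mem_filter => /andP[il _] ->; rewrite H// mulr0.
Qed.

Lemma wdot_col d (Psi : 'M[R]_(m, d)) i j :
  wdot W (col i Psi) (col j Psi) = (Psi^T *m W *m Psi) i j.
Proof.
rewrite /wdot mxE [RHS]mxE; apply: eq_bigr => k _; rewrite !mxE; congr (_ * _).
by apply: eq_bigr => k' _; rewrite !mxE.
Qed.

Section Orthonormal.
Context {d : nat} {Psi : 'M[R]_(m, d)}.
Context (Psi_orth : forall i j : 'I_d, wdot W (col i Psi) (col j Psi) = (i == j)%:R).

Lemma wdot_orth_comb (P : pred 'I_d) (c : 'I_d -> R) j : P j ->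
  wdot W (\sum_(i | P i) c i *: col i Psi) (col j Psi) = c j.
Proof.
move=> Pj; rewrite (wdot_suml Wdiag) (bigD1 j)//= big1; last first.
  by move=> i /andP[_ /negbTE ij]; rewrite (wdotZl Wdiag) Psi_orth ij mulr0.
by rewrite (wdotZl Wdiag) Psi_orth eqxx mulr1 addr0.
Qed.

Lemma wnorm_orth_comb (P : pred 'I_d) (c : 'I_d -> R) :
  wnorm W (\sum_(i | P i) c i *: col i Psi) ^+ 2 = \sum_(i | P i) c i ^+ 2.
Proof.
rewrite (wnorm_sqr Wdiag Wpos) (wdot_sumr Wdiag); apply: eq_bigr => i Pi.
by rewrite (wdotZr Wdiag) wdot_orth_comb// expr2.
Qed.

Lemma pod_proj_orth (l : nat) v (i : 'I_d) : (i < l)%N ->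
  wdot W (v - pod_proj Psi l v) (col i Psi) = 0.
Proof. by move=> il; rewrite (wdotBl Wdiag) wdot_orth_comb// subrr. Qed.

End Orthonormal.

Lemma sqrt_diag_mx n (a : 'rV[R]_n) :
  sqrt_diag (diag_mx a) = diag_mx (map_mx Num.sqrt a).
Proof.
apply/matrixP => i j; rewrite !mxE.
by case: eqVneq => _; rewrite ?mulr1n// !mulr0n sqrtr0.
Qed.

Lemma sqrt_diagW : let S := sqrt_diag W in
  [/\ S^T = S, S *m S = W & S \in unitmx].
Proof.
set S := sqrt_diag W.
have -> : W = diag_mx (\row_i W i i).
  apply/matrixP => i j; rewrite !mxE; case: eqVneq => [->|ij]; first by rewrite mulr1n.
  by rewrite mulr0n (is_diag_mxP Wdiag).
have -> : S = diag_mx (\row_i Num.sqrt (W i i)).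
  apply/matrixP => i j; rewrite !mxE; case: eqVneq => [->|ij]; first by rewrite mulr1n.
  by rewrite mulr0n (is_diag_mxP Wdiag)// sqrtr0.
split; first by rewrite tr_diag_mx.
- rewrite mulmx_diag; congr diag_mx; apply/rowP => i; rewrite !mxE -expr2 sqr_sqrtr//.
  exact: ltW.
- rewrite unitmxE det_diag unitfE; apply/prodf_neq0 => i _.
  by rewrite mxE gt_eqF// sqrtr_gt0.
Qed.

(** With [S] the square root of [W], the Gram matrix is [U^T S^-1 W S^-1 U = U^T U]. *)
Lemma pod_basis_orth n d (Y : 'M[R]_(m, n)) (alpha : 'rV[R]_n) (sigma : 'rV[R]_d)
    (Psi : 'M[R]_(m, d)) : pod_basis W Y alpha sigma Psi ->
  forall i j : 'I_d, wdot W (col i Psi) (col j Psi) = (i == j)%:R.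
Proof.
move=> [U [V [[UU _ _ _ _] ->]]] i j; have [ST SS Su] := sqrt_diagW.
have E : invmx (sqrt_diag W) *m W = sqrt_diag W.
  by rewrite -[X in _ *m X]SS mulKmx.
rewrite wdot_col trmx_mul trmx_inv ST -(mulmxA _ _ W) E.
by rewrite mulmxA mulmxK// UU mxE.
Qed.

(** The decomposition reads [sqrt alpha_j y_j = sum_i sigma_i V_ji psi_i], and the projection
    truncates this sum at [l]. Summing squared norms over [j] leaves [sigma_i^2], as the columns of
    [V] are unit vectors. *)
Lemma pod_basis_error n d (Y : 'M[R]_(m, n)) (alpha : 'rV[R]_n) (sigma : 'rV[R]_d)
    (Psi : 'M[R]_(m, d)) (l : nat) : pod_basis W Y alpha sigma Psi ->
  (forall j, 0 <= alpha 0 j) ->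
  \sum_j alpha 0 j * wnorm W (col j Y - pod_proj Psi l (col j Y)) ^+ 2 =
  \sum_(i < d | (l <= i)%N) sigma 0 i ^+ 2.
Proof.
move=> pb a0; have Po := pod_basis_orth _ _ _ _ _ _ pb.
case: pb => U [V [[UU VV E _ _] EPsi]]; have [ST SS Su] := sqrt_diagW.
pose c (j : 'I_n) (i : 'I_d) := sigma 0 i * V j i.
have EY : Y *m sqrt_diag (diag_mx alpha) = Psi *m diag_mx sigma *m V^T.
  rewrite EPsi -!mulmxA (mulmxA U) -E !mulmxA mulVmx// mul1mx.
  by [].
have colY j : Num.sqrt (alpha 0 j) *: col j Y = \sum_i c j i *: col i Psi.
  apply/matrixP => k z; rewrite ord1 summxE.
  have := congr1 (fun M : 'M[R]_(m, n) => M k j) EY.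
  rewrite sqrt_diag_mx mul_mx_diag !mxE mulrC => ->.
  apply: eq_bigr => i _; rewrite mul_mx_diag !mxE /c.
  by ring.
have term j : alpha 0 j * wnorm W (col j Y - pod_proj Psi l (col j Y)) ^+ 2 =
    \sum_(i < d | (l <= i)%N) c j i ^+ 2.
  rewrite -{1}(sqr_sqrtr (a0 j)) -(ger0_norm (sqrtr_ge0 (alpha 0 j))).
  rewrite -exprMn -(wnormZ Wdiag) scalerBr colY.
  have -> : Num.sqrt (alpha 0 j) *: pod_proj Psi l (col j Y) =
      \sum_(i < d | (i < l)%N) c j i *: col i Psi.
    rewrite scaler_sumr; apply: eq_bigr => i il.
    by rewrite scalerA -(wdotZl Wdiag) colY (wdot_orth_comb Po).
  rewrite (bigID (fun i : 'I_d => (i < l)%N))/= addrC addrK.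
  rewrite (wnorm_orth_comb Po).
  by apply: eq_bigl => i; rewrite -leqNgt.
under eq_bigr do rewrite term.
rewrite exchange_big; apply: eq_bigr => i _.
have : (V^T *m V) i i = 1 by rewrite VV mxE eqxx.
rewrite mxE => H; rewrite -[RHS]mulr1 -H mulr_sumr.
by apply: eq_bigr => j _; rewrite !mxE /c exprMn -expr2.
Qed.

End ProperOrthogonalDecomposition.

(** * Energy estimate *)

Section EnergyEstimate.
Context {R : realType}.

Lemma sqr_sum_le (N : nat) (a : nat -> R) :
  (\sum_(j < N) a j) ^+ 2 <= N%:R * \sum_(j < N) a j ^+ 2.
Proof.
have [->|N0] := posnP N; first by rewrite !big_ord0 expr0n mulr0.
have Np : 0 < N%:R :> R by rewrite ltr0n.
set S := \sum_(j < N) a j; set Q := \sum_(j < N) _.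
have : 0 <= \sum_(j < N) (N%:R * a j - S) ^+ 2 by rewrite sumr_ge0// => j _; exact: sqr_ge0.
have -> : \sum_(j < N) (N%:R * a j - S) ^+ 2 = N%:R * (N%:R * Q - S ^+ 2).
  rewrite (eq_bigr (fun j : 'I_N => N%:R ^+ 2 * a j ^+ 2 +
    (- (2 * N%:R * S) * a j + S ^+ 2))); last by move=> j _; ring.
  rewrite !big_split/= -!mulr_sumr -/S -/Q sumr_const card_ord -mulr_natl.
  by ring.
by rewrite pmulr_rge0// subr_ge0.
Qed.

Lemma midpoint_gronwall (N : nat) (t G : nat -> R) (c dt : R) :
  0 <= c -> 0 < dt -> c * dt <= 1 -> t 0%N = 0 ->
  (forall j, 0 <= t j) -> (forall j, 0 <= G j) ->
  (forall j, (j < N)%N ->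
    t j.+1 - t j <= dt * (c * ((t j.+1 + t j) / 2) + G j)) ->
  forall k, (k <= N)%N ->
  t k ^+ 2 <= expR (2 * c * (N%:R * dt)) ^+ 2 * (4 * (N%:R * dt) * \sum_(j < N) dt * G j ^+ 2).
Proof.
move=> c0 dt0 cdt t00 t0 G0 Ht k kN.
have cd0 : 0 <= c * dt by rewrite mulr_ge0// ltW.
pose E := 1 + 2 * c * dt.
have E1 : 1 <= E by rewrite /E; clear -cd0; lra.
have E0 : 0 < E by exact: lt_le_trans E1.
(* With [x = c * dt / 2 <= 1/2], solving the implicit inequality for [t j.+1] uses
   [(1 + x) / (1 - x) <= 1 + 4 * x] and [1 / (1 - x) <= 2]. *)
have step j : (j < N)%N -> t j.+1 <= E * t j + 2 * (dt * G j).
  move=> /Ht; have := t0 j; have := mulr_ge0 (ltW dt0) (G0 j); rewrite /E mulrDr.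
  have -> : dt * (c * ((t j.+1 + t j) / 2)) = (c * dt / 2) * (t j.+1 + t j) by field.
  have -> : 1 + 2 * c * dt = 1 + 4 * (c * dt / 2) by field.
  have x0 : 0 <= c * dt / 2 by rewrite divr_ge0.
  have x1 : c * dt / 2 <= 1 / 2 by clear -cdt; lra.
  move: (c * dt / 2) (dt * G j) (t j.+1) (t j) x0 x1; clear => x g a b x0 x1 g0 b0 H.
  have x1' : 0 < 1 - x by lra.
  rewrite -(ler_pM2l x1').
  have := mulr_ge0 g0 (_ : 0 <= 1 - 2 * x).
  have := mulr_ge0 (mulr_ge0 x0 b0) (_ : 0 <= 1 - 2 * x).
  by move=> /(_ ltac:(lra)) H1 /(_ ltac:(lra)) H2; lra.
have sG0 k' : 0 <= \sum_(j < k') dt * G j.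
  by rewrite sumr_ge0// => j _; rewrite mulr_ge0// ltW.
have bnd k' : (k' <= N)%N -> t k' <= E ^+ k' * (2 * \sum_(j < k') dt * G j).
  elim: k' => [|k' IH] kN'; first by rewrite t00 big_ord0 !mulr0.
  apply: le_trans (step k' kN') _; rewrite big_ord_recr/= !mulrDr; apply: lerD.
    by rewrite exprS -mulrA ler_pM2l// IH// ltnW.
  rewrite ler_peMl ?mulr_ge0 ?exprn_ege1// ltW//.
have NT0 : 0 <= N%:R * dt by rewrite mulr_ge0// ltW.
have Ek : E ^+ k <= expR (2 * c * (N%:R * dt)).
  have -> : 2 * c * (N%:R * dt) = N%:R * (2 * c * dt) by ring.
  rewrite expRM_natl; apply: (@le_trans _ _ (E ^+ N)).
    by rewrite ler_weXn2l.
  by rewrite lerXn2r ?nnegrE ?expR_ge0 ?(ltW E0)// expR_ge1Dx.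
have sk : \sum_(j < k) dt * G j <= \sum_(j < N) dt * G j.
  rewrite (big_ord_widen _ (fun j => dt * G j) kN) big_mkcond/=.
  by apply: ler_sum => j _; case: ifP => // _; rewrite mulr_ge0// ltW.
have tk : t k <= expR (2 * c * (N%:R * dt)) * (2 * \sum_(j < N) dt * G j).
  apply: le_trans (bnd k kN) _; apply: ler_pM => //.
  - by rewrite exprn_ge0// ltW.
  - by rewrite mulr_ge0.
  - by rewrite ler_pM2l.
apply: (@le_trans _ _ ((expR (2 * c * (N%:R * dt)) * (2 * \sum_(j < N) dt * G j)) ^+ 2)).
  by rewrite ler_sqr// nnegrE ?mulr_ge0 ?expR_ge0.
rewrite exprMn; apply: ler_wpM2l; first exact: sqr_ge0.
have := sqr_sum_le N (fun j => dt * G j).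
have -> : \sum_(j < N) (dt * G j) ^+ 2 = dt * \sum_(j < N) dt * G j ^+ 2.
  by rewrite mulr_sumr; apply: eq_bigr => j _; ring.
by move=> H; rewrite exprMn; lra.
Qed.

(** The energy inequality becomes linear by factoring [a^2 - b^2] and cancelling [a + b], once [q]
    is replaced by the larger [(a + b) / 2]. If [a + b] is 0, both terms vanish. *)
Lemma midpoint_norm_step (a b q G dt c e : R) : 0 <= a -> 0 <= b -> 0 < dt ->
  0 <= c -> 0 <= G ->
  q <= (a + b) / 2 -> 0 <= q ->
  a ^+ 2 - b ^+ 2 <= dt * 2 * ((c * q + G) * q) ->
  a - b <= dt * (c * ((a + b) / 2) + G).
Proof.
move=> a0 b0 dt0 c0 G0 qab q0 H.
have [ab|ab] := ltP 0 (a + b); last first.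
  have -> : a = 0 by lra.
  have -> : b = 0 by lra.
  rewrite subrr addr0 mul0r mulr0 add0r; exact: mulr_ge0 (ltW dt0) G0.
rewrite -(ler_pM2r ab) -subr_sqr; apply: le_trans H _.
have -> : dt * (c * ((a + b) / 2) + G) * (a + b) =
  dt * 2 * ((c * ((a + b) / 2) + G) * ((a + b) / 2)) by field.
apply: ler_wpM2l; first by rewrite mulr_ge0// ltW.
apply: ler_pM => //; first by rewrite addr_ge0// mulr_ge0.
by rewrite lerD2r ler_wpM2l.
Qed.

End EnergyEstimate.

(** * Consistency and error recursion in the weighted norm *)

Section VectorConsistency.
Context {R : realType} {m : nat} {W : 'M[R]_m}.
Context (Wdiag : is_diag_mx W) (Wpos : forall i : 'I_m, 0 < W i i).

Lemma sum_wnorm_sqr_le (N : nat) (dt K : R) (F : nat -> 'cV[R]_m) (C : 'I_m -> R) :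
  (forall i, \sum_(j < N) dt * F j i 0 ^+ 2 <= C i * K) ->
  \sum_(j < N) dt * wnorm W (F j) ^+ 2 <= (\sum_i W i i * C i) * K.
Proof.
move=> H; under eq_bigr do rewrite (wnorm_sqrE Wdiag Wpos) mulr_sumr.
rewrite exchange_big mulr_suml/=; apply: ler_sum => i _.
have := ler_wpM2l (ltW (Wpos i)) (H i); rewrite mulrA mulr_sumr.
by under eq_bigr do rewrite mulrCA.
Qed.

Lemma midpoint_consistency (T : R) (y dy yttt : R -> 'cV[R]_m) : 0 < T ->
  has_derivative_on T y dy -> weak_deriv3 T y yttt -> in_L2 T yttt ->
  exists2 C, 0 <= C & forall (N : nat) dt, (0 < N)%N -> N%:R * dt = T ->
    \sum_(j < N) dt * wnorm W (2^-1 *: (y (tgrid dt j.+1) + y (tgrid dt j))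
       - y (tgrid dt j.+1 - dt / 2)) ^+ 2 <= C * dt ^+ 4 /\
    \sum_(j < N) dt * wnorm W (dt^-1 *: (y (tgrid dt j.+1) - y (tgrid dt j))
       - dy (tgrid dt j.+1 - dt / 2)) ^+ 2 <= C * dt ^+ 4.
Proof.
move=> T0 yd weak yL2.
have sc (i : 'I_m) := scalar_midpoint_consistency _ _ _ _ T0
  (has_derivative_on_coord _ _ _ _ i yd) (yL2 i) (fun phi tphi => weak phi tphi i).
pose P (i : 'I_m) (C : R) := 0 <= C /\
   forall (N : nat) dt, (0 < N)%N -> N%:R * dt = T ->
    \sum_(j < N) dt * (2^-1 * (y (tgrid dt j.+1) i 0 + y (tgrid dt j) i 0)
       - y (tgrid dt j.+1 - dt / 2) i 0) ^+ 2 <= C * dt ^+ 4 /\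
    \sum_(j < N) dt * (dt^-1 * (y (tgrid dt j.+1) i 0 - y (tgrid dt j) i 0)
       - dy (tgrid dt j.+1 - dt / 2) i 0) ^+ 2 <= C * dt ^+ 4.
have /choice[C HC] : forall i, exists C, P i C.
  by move=> i; have [C C0 H] := sc i; exists C.
exists (\sum_i W i i * C i).
  by rewrite sumr_ge0// => i _; rewrite mulr_ge0 ?(ltW (Wpos i))//; have [] := HC i.
move=> N dt N0 NT; split.
- apply: (sum_wnorm_sqr_le N dt _ (fun j => 2^-1 *: (y (tgrid dt j.+1) + y (tgrid dt j))
       - y (tgrid dt j.+1 - dt / 2)) C) => i.
  have [_ /(_ N dt N0 NT)[H _]] := HC i.
  by under eq_bigr do rewrite !mxE.
- apply: (sum_wnorm_sqr_le N dt _ (fun j => dt^-1 *: (y (tgrid dt j.+1) - y (tgrid dt j))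
       - dy (tgrid dt j.+1 - dt / 2)) C) => i.
  have [_ /(_ N dt N0 NT)[_ H]] := HC i.
  by under eq_bigr do rewrite !mxE.
Qed.

End VectorConsistency.

Section GalerkinError.
Context {R : realType} {m : nat} {W : 'M[R]_m}.
Context (Wdiag : is_diag_mx W) (Wpos : forall i : 'I_m, 0 < W i i).

(* The W-orthogonality of the projection cancels the discrete derivative of
   the projection error, so only consistency errors drive the recursion. *)
Lemma galerkin_midpoint_step d (Psi : 'M[R]_(m, d)) (l : nat) (A : 'M[R]_m)
    (y1 y0 Y1 Y0 p1 p0 fY fy ym dym : 'cV[R]_m) (dt Lf c : R) :
  c = wopnorm W A + Lf -> 0 <= Lf -> 0 < dt ->
  p1 \in pod_space Psi l -> p0 \in pod_space Psi l ->
  (forall i : 'I_d, (i < l)%N -> wdot W (y1 - p1) (col i Psi) = 0) ->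
  (forall i : 'I_d, (i < l)%N -> wdot W (y0 - p0) (col i Psi) = 0) ->
  Y1 \in pod_space Psi l -> Y0 \in pod_space Psi l ->
  (forall i : 'I_d, (i < l)%N -> wdot W (dt^-1 *: (Y1 - Y0)) (col i Psi) =
     wdot W (2^-1 *: (A *m (Y1 + Y0)) + fY) (col i Psi)) ->
  dym = A *m ym + fy ->
  wnorm W (fY - fy) <= Lf * wnorm W (2^-1 *: (Y1 + Y0) - ym) ->
  wnorm W (Y1 - p1) - wnorm W (Y0 - p0) <=
  dt * (c * ((wnorm W (Y1 - p1) + wnorm W (Y0 - p0)) / 2) +
    (c * (wnorm W (2^-1 *: ((y1 - p1) + (y0 - p0)))
          + wnorm W (2^-1 *: (y1 + y0) - ym))
     + wnorm W (dt^-1 *: (y1 - y0) - dym))).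
Proof.
move=> Ec Lf0 dt0 P1V P0V O1 O0 Y1V Y0V sch Edym HfY.
have c0 : 0 <= c by rewrite Ec addr_ge0 ?(wopnorm_ge0 Wdiag Wpos).
set Yb := 2^-1 *: (Y1 + Y0).
set rho := 2^-1 *: (y1 - p1 + (y0 - p0)).
set r := 2^-1 *: (y1 + y0) - ym.
set tau := dt^-1 *: (y1 - y0) - dym.
(* The test vector is the mean of the two errors: paired with their difference it gives a difference
   of squared norms, as in the continuous energy identity. *)
set thb := 2^-1 *: ((Y1 - p1) + (Y0 - p0)).
have thV : thb \in pod_space Psi l by rewrite rpredZ// rpredD// rpredB.
(* This is what remains on subtracting the projected exact equation from the scheme, where
   [dt^-1 *: (y1 - y0)] equals [dym + tau]. *)
set F := A *m (Yb - ym) + (fY - fy) - tau.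
have orth : wdot W (dt^-1 *: ((Y1 - p1) - (Y0 - p0)) - F) thb = 0.
  apply: (pod_space_orth Wdiag _ Psi l _ _ _ thV) => i il.
  have := sch i il; have := O1 i il; have := O0 i il.
  rewrite /F /tau Edym /Yb mulmxBr -scalemxAr.
  rewrite !(wdotBl Wdiag, wdotDl Wdiag, wdotZl Wdiag) => h1 h2 h3.
  have h1' : wdot W p0 (col i Psi) = wdot W y0 (col i Psi) by lra.
  have h2' : wdot W p1 (col i Psi) = wdot W y1 (col i Psi) by lra.
  rewrite h1' h2'; lra.
have EF : wdot W (dt^-1 *: ((Y1 - p1) - (Y0 - p0))) thb = wdot W F thb.
  by apply/eqP; rewrite -subr_eq0 -(wdotBl Wdiag) orth.
have EY : Yb - ym = (thb - rho) + r.
  apply/matrixP => i j; rewrite /Yb /thb /rho /r !mxE; ring.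
have NY : wnorm W (Yb - ym) <= wnorm W thb + wnorm W rho + wnorm W r.
  rewrite EY; apply: le_trans (wnormD Wdiag Wpos _ _) _; rewrite lerD2r.
  by apply: le_trans (wnormD Wdiag Wpos _ _) _; rewrite (wnormN Wdiag).
have NF : wnorm W F <= c * wnorm W thb + (c * (wnorm W rho + wnorm W r) + wnorm W tau).
  apply: le_trans (wnormD Wdiag Wpos _ _) _; rewrite (wnormN Wdiag).
  rewrite [leRHS]addrA lerD2r; apply: le_trans (wnormD Wdiag Wpos _ _) _.
  apply: le_trans (lerD (wnorm_mulmx Wdiag Wpos _ _) HfY) _.
  by rewrite -mulrDl -Ec -mulrDr addrA; apply: ler_wpM2l.
apply: (@midpoint_norm_step _ _ _ (wnorm W thb)) => //; try exact: wnorm_ge0.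
- by rewrite addr_ge0 ?wnorm_ge0// mulr_ge0// addr_ge0 ?wnorm_ge0.
- rewrite (wnormZ Wdiag) ger0_norm ?invr_ge0// mulrC.
  by apply: ler_wpM2r; rewrite ?invr_ge0// (wnormD Wdiag Wpos).
- apply: (@le_trans _ _ (dt * 2 * wdot W F thb)).
    rewrite -EF /thb (wdotZl Wdiag) (wdotZr Wdiag) !(wnorm_sqr Wdiag Wpos).
    have sq a b : wdot W (a - b) (a + b) = wdot W a a - wdot W b b.
      by rewrite (wdotBl Wdiag) !(wdotDr Wdiag) (wdotC Wdiag b a); ring.
    rewrite sq; move: (wdot _ _ _) (wdot _ _ _) => a b.
    by rewrite le_eqVlt; apply/orP; left; apply/eqP; field; rewrite gt_eqF.
  apply: ler_wpM2l; first by rewrite mulr_ge0// ltW.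
  apply: le_trans (wdot_le Wdiag Wpos _ _) _.
  by apply: ler_wpM2r; first exact: wnorm_ge0.
Qed.

End GalerkinError.

Section TrapezoidalWeights.
Context {R : realType}.

Lemma trap_weight_le n (dt : R) (j : 'I_n) : 0 <= dt ->
  dt / 2 <= trap_weight n dt 0 j <= dt.
Proof. by move=> dt0; rewrite mxE; case: ifP => _; apply/andP; split; lra. Qed.

(** Each node belongs to at most two cells, and [dt] is at most twice its weight; hence the factor
    4. *)
Lemma sum_trap_weight_ge (N : nat) (dt : R) (F : nat -> R) : 0 <= dt ->
  (forall j, 0 <= F j) ->
  \sum_(j < N) dt * (F j.+1 + F j) <=
    4 * \sum_(j < N.+1) trap_weight N.+1 dt 0 j * F j.
Proof.
move=> dt0 F0.
have H : \sum_(j < N.+1) dt * F j <= 2 * \sum_(j < N.+1) trap_weight N.+1 dt 0 j * F j.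
  rewrite mulr_sumr; apply: ler_sum => j _; rewrite mulrA; apply: ler_wpM2r => //.
  by have /andP[h _] := trap_weight_le N.+1 dt j dt0; lra.
under eq_bigr do rewrite mulrDr.
rewrite big_split/=.
have H1 : \sum_(j < N) dt * F j.+1 <= \sum_(j < N.+1) dt * F j.
  by rewrite [leRHS]big_ord_recl lerDr mulr_ge0.
have H2 : \sum_(j < N) dt * F j <= \sum_(j < N.+1) dt * F j.
  by rewrite [leRHS]big_ord_recr lerDl mulr_ge0.
by lra.
Qed.

End TrapezoidalWeights.

(* C_E is chosen after y, T, the value normA of ||A||_W and L_f, and before
   A, f, K, n, l and the reduced model. *)
Theorem mainTheorem1 (R : realType) (m : nat) (W : 'M[R]_m)
    (Wdiag : is_diag_mx W) (Wpos : forall i : 'I_m, 0 < W i i)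
    (T : R) (T_gt0 : 0 < T)
    (y dy : R -> 'cV[R]_m) (y_deriv : has_derivative_on T y dy)
    (yttt : R -> 'cV[R]_m) (y_yttt : weak_deriv3 T y yttt)
    (yttt_L2 : in_L2 T yttt)
    (normA Lf : R) (Lf_ge0 : 0 <= Lf) :
  exists CE : R, 0 < CE /\
  forall (A : 'M[R]_m) (f : R -> 'cV[R]_m -> 'cV[R]_m)
      (y0 : 'cV[R]_m) (K : set 'cV[R]_m),
    wopnorm W A = normA ->
    {within `[0, T] `*` [set: 'cV[R]_m],
      continuous (fun p : R * 'cV[R]_m => f p.1 p.2)} ->
    locally_lipschitz_snd W T f ->
    (forall t : R, t \in `[0, T] -> dy t = A *m y t + f t (y t)) ->
    y 0 = y0 ->
    (forall (t : R) (u v : 'cV[R]_m), t \in `[0, T] -> K u -> K v ->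
      wnorm W (f t u - f t v) <= Lf * wnorm W (u - v)) ->
  forall (n : nat) (dt : R),
    (2 <= n)%N -> dt = T / (n.-1)%:R -> dt <= 1 ->
    Num.max (wopnorm W A) Lf * dt <= 1 / 2 ->
  forall (d : nat) (sigma : 'rV[R]_d) (Psi : 'M[R]_(m, d)),
    d = \rank (snapshots n dt y) ->
    pod_basis W (snapshots n dt y) (trap_weight n dt) sigma Psi ->
  forall (l : nat) (Y : nat -> 'cV[R]_m),
    (1 <= l <= d)%N ->
    midpoint_scheme n l W A f y0 dt Psi Y ->
    (forall j : nat, (j.+1 < n)%N ->
      K (y (tgrid dt j.+1 - dt / 2)) /\ K (2^-1 *: (Y j.+1 + Y j))) ->
  \sum_(j < n) trap_weight n dt 0 j * wnorm W (y (tgrid dt j) - Y j) ^+ 2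
  <= CE * (\sum_(i < d | (l <= i)%N)
             (2 * sigma 0 i ^+ 2
              + \sum_(j < n) trap_weight n dt 0 j
                  * `|wdot W (dy (tgrid dt j)) (col i Psi)| ^+ 2)
           + dt ^+ 4).
Proof.
have [C C0 HC] := midpoint_consistency Wdiag Wpos T y dy yttt T_gt0 y_deriv y_yttt yttt_L2.
(* [normA] has no known sign until [A] is introduced, so [c] enters the constants only through
   squares. *)
set c := normA + Lf; set EX := expR (2 * c * T) ^+ 2.
have EX0 : 0 <= EX by exact: sqr_ge0.
have T2 := sqr_ge0 T; have c2 := sqr_ge0 c.
have c3 : 0 <= c ^+ 2 + 1 by exact: addr_ge0.
(* [K1] and [K2] are the coefficients of [S] and [dt^4] in [2 * S + 16 * T^2 * EX * Gam], where [Gam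
   = 6 * c^2 * S + 3 * (c^2 + 1) * C * dt^4]. *)
have K10 : 0 <= 2 + 96 * T ^+ 2 * EX * c ^+ 2.
  by apply: addr_ge0 => //; do 3![apply: mulr_ge0 => //].
have K20 : 0 <= 48 * T ^+ 2 * EX * (c ^+ 2 + 1) * C.
  by do 4![apply: mulr_ge0 => //].
set K1 := 2 + _ in K10; set K2 := 48 * _ * _ * _ * _ in K20.
exists (1 + K1 + K2); split; first by rewrite -addrA ltr_pwDl// addr_ge0.
move=> A f y0 K EA _ _ ode yy0 fLip n dt n2 Edt dt1 cdt d sigma Psi _ pod l Y _.
move=> [YV Y0 sch] HK.
case: n n2 Edt pod YV sch HK => [//|N]; rewrite ltnS /= => N0 Edt pod YV sch HK.
have Np : 0 < N%:R :> R by rewrite ltr0n.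
have NT : N%:R * dt = T by rewrite Edt mulrC divfK// gt_eqF.
have dt0 : 0 < dt by rewrite Edt divr_gt0.
have nA0 : 0 <= normA by rewrite -EA (wopnorm_ge0 Wdiag Wpos).
have c0 : 0 <= c by rewrite addr_ge0.
(* The sum [c] is at most twice the maximum in the step-size hypothesis, which turns 1/2 into the 1
   required by the Gronwall lemma. *)
have cdt1 : c * dt <= 1.
  have hA : normA * dt <= 1 / 2.
    by apply: le_trans cdt; rewrite ler_pM2r// le_max EA lexx.
  have hL : Lf * dt <= 1 / 2.
    by apply: le_trans cdt; rewrite ler_pM2r// le_max lexx orbT.
  by rewrite /c mulrDl; clear -hA hL; lra.
have [HC1 HC2] := HC N dt N0 NT.
pose Z j := pod_proj (W := W) Psi l (y (tgrid dt j)).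
have Po := pod_basis_orth Wdiag Wpos _ _ _ _ _ _ pod.
have ZV j : Z j \in pod_space Psi l by exact: pod_proj_in.
have ZO j (i : 'I_d) : (i < l)%N -> wdot W (y (tgrid dt j) - Z j) (col i Psi) = 0.
  by move=> il; exact: (pod_proj_orth Wdiag Po).
set al := trap_weight N.+1 dt.
have al0 j : 0 <= al 0 j.
  have /andP[h _] := trap_weight_le N.+1 dt j (ltW dt0).
  by apply: le_trans h; rewrite divr_ge0// ltW.
pose S := \sum_(i < d | (l <= i)%N) sigma 0 i ^+ 2.
pose rho j := wnorm W (y (tgrid dt j) - Z j).
have ES : \sum_(j < N.+1) al 0 j * rho j ^+ 2 = S.
  rewrite /S -(pod_basis_error Wdiag Wpos _ _ _ _ _ _ l pod al0).
  apply: eq_bigr => j _.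
  have -> : col j (snapshots N.+1 dt y) = y (tgrid dt j).
    by apply/matrixP => a b; rewrite !mxE ord1.
  by [].
have S0 : 0 <= S by rewrite sumr_ge0// => i _; exact: sqr_ge0.
pose t j := wnorm W (Y j - Z j).
pose rb j := wnorm W (2^-1 *: ((y (tgrid dt j.+1) - Z j.+1) + (y (tgrid dt j) - Z j))).
pose r j := wnorm W (2^-1 *: (y (tgrid dt j.+1) + y (tgrid dt j))
  - y (tgrid dt j.+1 - dt / 2)).
pose tau j := wnorm W (dt^-1 *: (y (tgrid dt j.+1) - y (tgrid dt j))
  - dy (tgrid dt j.+1 - dt / 2)).
have {}HC1 : \sum_(j < N) dt * r j ^+ 2 <= C * dt ^+ 4 by exact: HC1.
have {}HC2 : \sum_(j < N) dt * tau j ^+ 2 <= C * dt ^+ 4 by exact: HC2.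
pose G j := c * (rb j + r j) + tau j.
have G0 j : 0 <= G j by rewrite addr_ge0 ?wnorm_ge0// mulr_ge0// addr_ge0 ?wnorm_ge0.
(* [Y 0] and [Z 0] lie in the POD space and have the same products with its basis, so their
   difference is orthogonal to itself. *)
have t00 : t 0%N = 0.
  have th0 : wdot W (Y 0%N - Z 0%N) (Y 0%N - Z 0%N) = 0.
    apply: (pod_space_orth Wdiag _ Psi l); last by rewrite rpredB// YV.
    move=> i il; have := ZO 0%N i il; rewrite !(wdotBl Wdiag) (Y0 i il).
    by rewrite /tgrid mul0r yy0.
  by rewrite /t /wnorm th0 sqrtr0.
have mid j : (j < N)%N -> tgrid dt j.+1 - dt / 2 \in `[0, T].
  move=> jN; rewrite in_itv/= /tgrid.
  have h1 : 0 <= j%:R * dt by rewrite mulr_ge0// ltW.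
  have h2 : j.+1%:R * dt <= T by rewrite -NT ler_pM2r// ler_nat.
  have h3 : j.+1%:R * dt = j%:R * dt + dt by rewrite -natr1 mulrDl mul1r.
  by apply/andP; split; clear -h1 h2 h3 dt0; lra.
have step j : (j < N)%N -> t j.+1 - t j <= dt * (c * ((t j.+1 + t j) / 2) + G j).
  move=> jN; have [Ky KY] := HK j jN.
  apply: (galerkin_midpoint_step Wdiag Wpos d Psi l A _ _ _ _ _ _
    (f (tgrid dt j.+1 - dt / 2) (2^-1 *: (Y j.+1 + Y j)))
    (f (tgrid dt j.+1 - dt / 2) (y (tgrid dt j.+1 - dt / 2)))
    _ _ _ Lf) => //.
  - by rewrite EA.
  - exact: ZO.
  - exact: ZO.
  - exact: YV.
  - by apply: YV; exact: ltnW.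
  - by move=> i il; exact: sch.
  - exact: ode (mid j jN).
  - exact: fLip (mid j jN) KY Ky.
have gron := midpoint_gronwall N t G c dt c0 dt0 cdt1 t00
  (fun j => wnorm_ge0 _) G0 step.
rewrite NT -/EX in gron.
(* The square of a sum of three terms gives the factor 3; for [rho], the cell mean contributes 1/2
   and the passage to trapezoidal weights 4, whence [6 * c^2]. *)
have SG : \sum_(j < N) dt * G j ^+ 2 <= 6 * c ^+ 2 * S + 3 * (c ^+ 2 + 1) * (C * dt ^+ 4).
  have B (j : 'I_N) : dt * G j ^+ 2 <=
      3 * c ^+ 2 / 2 * (dt * (rho j.+1 ^+ 2 + rho j ^+ 2)) +
      (3 * c ^+ 2 * (dt * r j ^+ 2) + 3 * (dt * tau j ^+ 2)).
    have Hrb : rb j ^+ 2 <= (rho j.+1 ^+ 2 + rho j ^+ 2) / 2.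
      rewrite /rb (wnormZ Wdiag) ger0_norm ?invr_ge0// exprMn.
      have := wnorm_sqrD Wdiag Wpos (y (tgrid dt j.+1) - Z j.+1) (y (tgrid dt j) - Z j).
      rewrite -/(rho j.+1) -/(rho j); move: (wnorm W _ ^+ 2) (rho _ ^+ 2 + _) => a b.
      have -> : (2^-1 : R) ^+ 2 = 4^-1 by field.
      by clear; lra.
    have -> : 3 * c ^+ 2 / 2 * (dt * (rho j.+1 ^+ 2 + rho j ^+ 2)) +
      (3 * c ^+ 2 * (dt * r j ^+ 2) + 3 * (dt * tau j ^+ 2)) =
      dt * (3 * c ^+ 2 * ((rho j.+1 ^+ 2 + rho j ^+ 2) / 2) +
       (3 * c ^+ 2 * r j ^+ 2 + 3 * tau j ^+ 2)) by field.
    apply: ler_wpM2l; first exact: ltW.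
    apply: (@le_trans _ _ (3 * c ^+ 2 * rb j ^+ 2 + (3 * c ^+ 2 * r j ^+ 2 + 3 * tau j ^+ 2))).
      rewrite /G; move: (rb j) (r j) (tau j) (c) => u v w e; clear.
      have := sqr_ge0 (e * u - e * v); have := sqr_ge0 (e * u - w).
      have := sqr_ge0 (e * v - w); lra.
    by rewrite lerD2r; apply: ler_wpM2l => //; rewrite mulr_ge0 ?sqr_ge0.
  apply: le_trans (ler_sum _ (fun j _ => B j)) _.
  rewrite !big_split/= -!mulr_sumr.
  have := sum_trap_weight_ge N dt (fun j => rho j ^+ 2) (ltW dt0) (fun j => sqr_ge0 _).
  rewrite -/al ES => H1.
  have c20 : 0 <= c ^+ 2 by exact: sqr_ge0.
  have P1 := ler_wpM2l c20 H1; have P2 := ler_wpM2l c20 HC1.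
  move: P1 P2 HC2; rewrite -!mulr_sumr.
  move: (\sum_(j < N) _) (\sum_(j < N) _) (\sum_(j < N) _) => s3 s2 s1.
  by clear; lra.
set Gam := 6 * c ^+ 2 * S + _ in SG.
have tk k : (k <= N)%N -> t k ^+ 2 <= EX * (4 * T * Gam).
  move=> kN; apply: le_trans (gron k kN) _; apply: ler_wpM2l => //.
  by apply: ler_wpM2l => //; rewrite mulr_ge0// ltW.
(* The count [N.+1 <= 2 * N], valid as [N] is positive, gives this bound. *)
have al_sum : \sum_(j < N.+1) al 0 j <= 2 * T.
  apply: (@le_trans _ _ (\sum_(j < N.+1) dt)).
    by apply: ler_sum => j _; have /andP[] := trap_weight_le N.+1 dt j (ltW dt0).
  rewrite sumr_const card_ord -[leLHS]mulr_natl -NT mulrA ler_pM2r// -natrM ler_nat.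
  by rewrite mul2n -addnn -addn1 leq_add2l.
have L1 : \sum_(j < N.+1) al 0 j * wnorm W (y (tgrid dt j) - Y j) ^+ 2 <=
    2 * S + 2 * (2 * T) * (EX * (4 * T * Gam)).
  have Q0 : 0 <= EX * (4 * T * Gam) by apply: le_trans (tk 0%N (leq0n _)); exact: sqr_ge0.
  apply: (@le_trans _ _ (\sum_(j < N.+1) (2 * (al 0 j * rho j ^+ 2) +
      2 * (al 0 j * (EX * (4 * T * Gam)))))).
    apply: ler_sum => j _.
    have -> : 2 * (al 0 j * rho j ^+ 2) + 2 * (al 0 j * (EX * (4 * T * Gam))) =
      al 0 j * (2 * (rho j ^+ 2 + EX * (4 * T * Gam))) by ring.
    apply: ler_wpM2l => //.
    have -> : y (tgrid dt j) - Y j = (y (tgrid dt j) - Z j) + - (Y j - Z j).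
      by rewrite opprB addrA subrK.
    apply: le_trans (wnorm_sqrD Wdiag Wpos _ _) _.
    rewrite (wnormN Wdiag) ler_pM2l// lerD2l; apply: tk.
    by rewrite -ltnS.
  rewrite big_split/= -!mulr_sumr ES lerD2l -mulr_suml mulrA.
  by apply: ler_wpM2r => //; rewrite ler_pM2l.
apply: le_trans L1 _.
set D := \sum_(i < d | _) _.
have SD : S <= D.
  apply: ler_sum => i _; rewrite mulr2n mulrDl mul1r -addrA lerDl addr_ge0 ?sqr_ge0//.
  by apply: sumr_ge0 => j _; rewrite mulr_ge0 ?sqr_ge0.
have d40 : 0 <= dt ^+ 4 by rewrite exprn_ge0// ltW.
have -> : 2 * S + 2 * (2 * T) * (EX * (4 * T * Gam)) = K1 * S + K2 * dt ^+ 4.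
  by rewrite /K1 /K2 /Gam; ring.
have D0 : 0 <= D by exact: le_trans SD.
have M1 := ler_wpM2l K10 SD.
have M2 := mulr_ge0 K10 d40; have M3 := mulr_ge0 K20 D0.
by move: M1 M2 M3 D0 d40; clear; lra.
Qed.
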